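(* Let $\mathcal{G}$ be an \'etale groupoid with the Fourier coefficients approximation property, let $\Gamma$ be a countable infinite abelian group (written additively, with identity $0$), let $c:\mathcal{G}\to\Gamma$ be a continuous $1$-cocycle, and let $M$ be a diagonal bimodule of $C_r^*(\mathcal{G})$. Then the following statements hold. (i) If $M$ is $\alpha^c$-invariant, then $M$ is spectral if and only if $M\cap C_r^*(\mathcal{G})_t$ is spectral for each $t\in\Gamma$. (ii) If $M$ is spectral, then $M$ is $\alpha^c$-invariant. Moreover, when $c^{-1}(0)=\mathcal{G}^{(0)}$, the converse also holds; that is, $M$ is spectral if and only if $M$ is $\alpha^c$-invariant.
   Context: An \'etale groupoid means a second countable, locally compact, Hausdorff topological groupoid $\mathcal{G}$ whose range and source maps $r,s:\mathcal{G}\to\mathcal{G}^{(0)}$ are local homeomorphisms; $\mathcal{G}^{(0)}$ is the unit space and $\mathcal{G}_u=s^{-1}(u)$. $C_c(\mathcal{G})$ is a $*$-algebra with $f^*(\gamma)=\overline{f(\gamma^{-1})}$ and $(fg)(\gamma)=\sum_{\gamma'\in\mathcal{G}_{s(\gamma)}}f(\gamma\gamma'^{-1})g(\gamma')$; $C_r^*(\mathcal{G})$ is its completion in the norm $\|f\|_{\mathrm{red}}=\sup_{u\in\mathcal{G}^{(0)}}\|\mathrm{Ind}_u(f)\|$, where $\mathrm{Ind}_u(f)\xi(\gamma)=\sum_{\gamma'\in\mathcal{G}_u}f(\gamma\gamma'^{-1})\xi(\gamma')$ on $\ell^2(\mathcal{G}_u)$. The inclusion $C_c(\mathcal{G})\subseteq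 C_0(\mathcal{G})$ extends to a norm-decreasing injective linear map $j:C_r^*(\mathcal{G})\to C_0(\mathcal{G})$, and each $a\in C_r^*(\mathcal{G})$ is identified with the function $j(a)$; write $a(\gamma)=j(a)(\gamma)$ and $\mathrm{supp}'(a)=\{\gamma\in\mathcal{G}:a(\gamma)\neq0\}$. $C_0(\mathcal{G}^{(0)})$ is regarded as a $C^*$-subalgebra of $C_r^*(\mathcal{G})$. For open $P\subseteq\mathcal{G}$, $C_c(P)\subseteq C_c(\mathcal{G})$ via extension by zero. A diagonal bimodule of $C_r^*(\mathcal{G})$ is a norm closed subspace $M$ such that $ab,ba\in M$ for all $a\in M$, $b\in C_0(\mathcal{G}^{(0)})$. Its spectrum is $\sigma(M)=\{\gamma\in\mathcal{G}:a(\gamma)\ne0\text{ for some }a\in M\}$. For open $P\subseteq\mathcal{G}$, $A(P)=\{a\in C_r^*(\mathcal{G}):a(\gamma)=0\text{ for all }\gamma\notin P\}$ (so $A(\emptyset)=\{0\}$). $M$ is spectral if $M=A(\sigma(M))$. $\mathcal{G}$ has the Fourier coefficients approximation property if $a\in\overline{C_c(\mathrm{supp}'(a))}$ (closure in the reduced norm) for all $a\in C_r^*(\mathcal{G})$. A continuous $1$-cocycle is a continuous groupoid homomorphism $c:\mathcal{G}\to\Gamma$ ($\Gamma$ discrete). Let $\widehat{\Gamma}$ be the dual group of $\Gamma$. The cocycle induces an action $\alpha^c$ of $\widehat\Gamma$ by automorphisms of $C_r^*(\mathcal{G})$ with $\alpha^c_\chi(a)(\gamma)=\chi(c(\gamma))a(\gamma)$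 for $\chi\in\widehat\Gamma$, $a\in C_r^*(\mathcal{G})$, $\gamma\in\mathcal{G}$. For $t\in\Gamma$, $\Phi_t(a)=\int_{\widehat\Gamma}\overline{\chi(t)}\,\alpha^c_\chi(a)\,d\chi$ (normalized Haar measure) and $C_r^*(\mathcal{G})_t=\Phi_t(C_r^*(\mathcal{G}))$ is the range of $\Phi_t$. $M$ is $\alpha^c$-invariant if $\alpha^c_\chi(M)\subseteq M$ for all $\chi\in\widehat\Gamma$. *)

(* Defs.v *)
From HB Require Import structures.
From mathcomp Require Import all_boot all_order all_algebra.
From mathcomp Require Import complex.
From mathcomp Require Import all_classical all_reals all_analysis.

Set Implicit Arguments.
Unset Strict Implicit.
Unset Printing Implicit Defensive.

Import Order.TTheory GRing.Theory Num.Theory.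
Import numFieldNormedType.Exports.

Local Open Scope classical_set_scope.
Local Open Scope ring_scope.

(* Norms of complex normed modules take their values in R[i]; [rnorm] is the
   same norm as an element of R. *)
Definition rnorm (R : realType) (V : normedModType R[i]) (x : V) : R :=
  complex.Re `|x|.

(* The product [gmul x y] is meaningful only if [src x = rng y]. *)
Record groupoid (G : Type) := Groupoid {
  rng : G -> G;
  src : G -> G;
  ginv : G -> G;
  gmul : G -> G -> G;
  rng_rng : forall x, rng (rng x) = rng x;
  rng_src : forall x, rng (src x) = src x;
  src_rng : forall x, src (rng x) = rng x;
  src_src : forall x, src (src x) = src x;
  rng_mul : forall x y, src x = rng y -> rng (gmul x y) = rng x;
  src_mul : forall x y, src x = rng y -> src (gmul x y) = src y;
  mul_assoc : forall x y z, src x = rng y -> src y = rng z ->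
    gmul x (gmul y z) = gmul (gmul x y) z;
  mul_rng : forall x, gmul (rng x) x = x;
  mul_src : forall x, gmul x (src x) = x;
  rng_inv : forall x, rng (ginv x) = src x;
  src_inv : forall x, src (ginv x) = rng x;
  mul_inv_l : forall x, gmul (ginv x) x = src x;
  mul_inv_r : forall x, gmul x (ginv x) = rng x
}.

Definition unit_space (G : Type) (S : groupoid G) : set G := range (src S).

Definition src_fiber (G : Type) (S : groupoid G) (u : G) : set G :=
  [set x | src S x = u].

Definition local_homeomorphism (X : topologicalType) (f : X -> X)
    (Y : set X) : Prop :=
  (forall x, Y (f x)) /\
  forall x, exists U : set X,
    [/\ open U, U x,
        exists2 V, open V & f @` U = V `&` Y &
        exists g : X -> X,
          [/\ {within U, continuous f}, {within f @` U, continuous g} &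
              forall y, U y -> g (f y) = y]].

Record etale (G : topologicalType) (S : groupoid G) : Prop := Etale {
  etale_second_countable : @second_countable G;
  etale_locally_compact : locally_compact [set: G];
  etale_hausdorff : hausdorff_space G;
  etale_inv : continuous (ginv S);
  etale_mul : {within [set p : G * G | src S p.1 = rng S p.2],
                continuous (fun p : G * G => gmul S p.1 p.2)};
  etale_rng : local_homeomorphism (rng S) (unit_space S);
  etale_src : local_homeomorphism (src S) (unit_space S)
}.

(* Continuous functions with compact support contained in P; for P open this
   is C_c(P), each function being extended by zero. *)
Definition Cc (R : realType) (G : topologicalType) (P : set G) :
    set (G -> R[i]^o) :=
  [set f | [/\ continuous f, compact (closure [set x | f x != 0]) &
               closure [set x | f x != 0] `<=` P]].

(* C_0(Y) for a subspace Y, each function being extended by zero. *)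
Definition C0 (R : realType) (G : topologicalType) (Y : set G) :
    set (G -> R[i]^o) :=
  [set f | [/\ {within Y, continuous f}, forall x, ~ Y x -> f x = 0 &
               forall e : R, 0 < e ->
                 exists2 K, compact K /\ K `<=` Y &
                   forall x, Y x -> ~ K x -> rnorm (f x) < e]].

Section ReducedAlgebra.
Context (R : realType) (G : topologicalType) (S : groupoid G).
Local Notation C := (R[i]^o).

(* In [convolution] and [Ind] the sums may run over infinite sets, but only
   finitely many terms are nonzero as soon as f is in C_c(G). *)
Definition convolution (f g : G -> C) (x : G) : C :=
  \sum_(y \in src_fiber S (src S x)) (f (gmul S x (ginv S y)) * g y).

Definition cc_star (f : G -> C) (x : G) : C := (f (ginv S x))^*%C.

Definition Ind (u : G) (f xi : G -> C) (x : G) : C :=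
  \sum_(y \in src_fiber S u) (f (gmul S x (ginv S y)) * xi y).

(* The norm of l^2(G_u); only the values of xi on G_u matter. *)
Definition l2norm (u : G) (xi : G -> C) : \bar R :=
  sqrte (\esum_(x in src_fiber S u) (rnorm (xi x) ^+ 2)%:E).

Definition Ind_norm (u : G) (f : G -> C) : \bar R :=
  ereal_sup [set l2norm u (Ind u f xi) | xi in [set xi | (l2norm u xi <= 1)%E]].

(* 0 is inserted for the sake of the empty groupoid. *)
Definition red_norm (f : G -> C) : \bar R :=
  ereal_sup (0%E |` [set Ind_norm u f | u in unit_space S]).

(* The completion of the *-algebra C_c(G) for the reduced norm, which is unique
   up to a unique isometric *-isomorphism. The values of [incl] outside C_c(G)
   are irrelevant. *)
Record reduced_algebra := ReducedAlgebra {
  carrier :> completeNormedModType R[i];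
  incl : (G -> C) -> carrier;
  amul : carrier -> carrier -> carrier;
  astar : carrier -> carrier;
  incl_linear : forall k f g, Cc setT f -> Cc setT g ->
    incl (k *: f + g) = k *: incl f + incl g;
  incl_norm : forall f, Cc setT f -> (rnorm (incl f))%:E = red_norm f;
  incl_dense : closure (incl @` Cc setT) = setT;
  amul_continuous : continuous (fun p : carrier * carrier => amul p.1 p.2);
  amul_incl : forall f g, Cc setT f -> Cc setT g ->
    amul (incl f) (incl g) = incl (convolution f g);
  astar_continuous : continuous astar;
  astar_incl : forall f, Cc setT f -> astar (incl f) = incl (cc_star f)
}.

Variable A : reduced_algebra.

Definition extends_inclusion (j : A -> G -> C) : Prop :=
  [/\ forall k a b, j (k *: a + b) = k *: j a + j b,
      forall a, C0 setT (j a),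
      forall a x, rnorm (j a x) <= rnorm a &
      forall f, Cc setT f -> j (incl A f) = f].

(* The map j : C*_r(G) -> C_0(G). *)
Definition fourier_coef : A -> G -> C := xget (fun _ _ => 0) extends_inclusion.

Definition supp' (a : A) : set G := [set x | fourier_coef a x != 0].

(* C_0 of the unit space inside C*_r(G). *)
Definition diagonal_subalgebra : set A :=
  [set b | C0 (unit_space S) (fourier_coef b)].

Definition diagonal_bimodule (M : set A) : Prop :=
  [/\ closed M, M 0, forall k a b, M a -> M b -> M (k *: a + b) &
      forall a b, M a -> diagonal_subalgebra b -> M (amul a b) /\ M (amul b a)].

Definition spectrum (M : set A) : set G :=
  [set x | exists2 a, M a & fourier_coef a x != 0].

Definition supported_in (P : set G) : set A :=
  [set a | forall x, ~ P x -> fourier_coef a x = 0].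

Definition spectral (M : set A) : Prop := M = supported_in (spectrum M).

Definition fourier_approximation : Prop :=
  forall a : A, closure (incl A @` Cc (supp' a)) a.

End ReducedAlgebra.

(* The dual group of a discrete abelian group, with the topology of pointwise
   convergence. *)
Section DualGroup.
Context (R : realType) (Gamma : zmodType).

Definition characters : set {ptws Gamma -> R[i]^o} :=
  [set chi | (forall s t, chi (s + t) = chi s * chi t) /\
             forall t, `|chi t| = 1].

Definition dual_group : Type := set_type characters.
HB.instance Definition _ := Topological.on dual_group.

Definition char_val (chi : dual_group) : Gamma -> R[i]^o := set_val chi.

Lemma char1_subproof : (fun=> 1) \in characters.
Proof. by rewrite inE; split=> [s t|t]; rewrite ?mulr1 ?normr1. Qed.

Definition char1 : dual_group :=
  exist (fun f => f \in characters) _ char1_subproof.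
HB.instance Definition _ := isPointed.Build dual_group char1.

Lemma charM_subproof (chi psi : dual_group) :
  (fun t => char_val chi t * char_val psi t) \in characters.
Proof.
have [chiD chi1] := set_mem (valP chi); have [psiD psi1] := set_mem (valP psi).
rewrite inE; split=> [s t|t].
  by rewrite /char_val /= !set_valE chiD psiD mulrACA.
by rewrite normrM /char_val !set_valE chi1 psi1 mulr1.
Qed.

Definition charM (chi psi : dual_group) : dual_group :=
  exist (fun f => f \in characters) _ (charM_subproof chi psi).

Definition borel_dual := g_sigma_algebraType (@open dual_group).

Definition haar (mu : probability borel_dual R) : Prop :=
  forall (chi : dual_group) (E : set borel_dual),
    measurable E -> mu (charM chi @` E) = mu E.

End DualGroup.

Section Bochner.
Context (R : realType) (d : measure_display) (T : measurableType d).
Context (mu : {measure set T -> \bar R}) (V : normedModType R[i]).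

Definition simple_map (s : T -> V) : Prop :=
  finite_set (range s) /\ forall v, measurable (s @^-1` [set v]).

Definition simple_integral (s : T -> V) : V :=
  \sum_(v \in range s) ((fine (mu (s @^-1` [set v])))%:C%C *: v).

Definition is_bochner_integral (F : T -> V) (x : V) : Prop :=
  exists s : nat -> T -> V,
    [/\ forall n, simple_map (s n),
        forall n, measurable_fun setT (fun t => rnorm (F t - s n t)),
        (\int[mu]_t (rnorm (F t - s n t))%:E)%E @[n --> \oo] --> 0%E &
        simple_integral (s n) @[n --> \oo] --> x].

Definition bochner_integral (F : T -> V) : V := xget 0 (is_bochner_integral F).

End Bochner.

Section Cocycle.
Context (R : realType) (G : topologicalType) (S : groupoid G).
Context (Gamma : zmodType).

Definition cocycle (c : G -> Gamma) : Prop :=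
  continuous (c : G -> discrete_topology Gamma) /\
  forall x y, src S x = rng S y -> c (gmul S x y) = c x + c y.

Context (A : reduced_algebra R S) (c : G -> Gamma).

(* The automorphism alpha^c_chi. *)
Definition dual_action (chi : dual_group R Gamma) (a : A) : A :=
  xget 0 [set b | forall x,
    fourier_coef b x = char_val chi (c x) * fourier_coef a x].

Definition dual_invariant (M : set A) : Prop :=
  forall chi, dual_action chi @` M `<=` M.

Definition Phi (mu : probability (borel_dual R Gamma) R) (t : Gamma) (a : A) :
    A :=
  bochner_integral mu (fun chi => (char_val chi t)^*%C *: dual_action chi a).

(* The spectral subspace C*_r(G)_t. *)
Definition spectral_subspace (mu : probability (borel_dual R Gamma) R)
    (t : Gamma) : set A := range (Phi mu t).

End Cocycle.

(* Main.v *)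
Require Import Defs.
From mathcomp Require Import all_boot all_order all_algebra.
From mathcomp Require Import complex finmap.
From mathcomp Require Import all_classical all_reals all_analysis.
From mathcomp Require Import measurable_realfun ring lra.

(** The coefficient map j identifies the algebra with a space of functions
    on the groupoid, and the point of the proof is that everything of interest
    can be read off from coefficients: j is injective (fourier_inj), the dual
    action multiplies the x-coefficient by chi(c x) (dual_actionE), and Phi_t
    restricts coefficients to the fibre of c over t (coef_Phi_eq,
    coef_Phi_neq).  So the spectral subspace at t consists of the elements
    supported in that fibre (spectral_subspaceE).

    The existence of j comes from the bound of f(x) by the reduced norm, tested
    on a delta function.  Its injectivity comes from the matrix coefficients of
    Ind_u(a), which are the coefficients of a (red_norm_lim).  The dual action is
    isometric because multiplication by chi(c x) conjugates each Ind_u by a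
    diagonal unitary (red_norm_phase).

    The integrand of Phi_t depends, up to a small error, on finitely many
    coordinates of the character, and these take values in a bounded set; so it
    is a uniform limit of simple maps with values among its own values, and its
    Bochner integral exists (Phi_limit).  Hence Phi_t(a) stays in every closed
    invariant subspace that contains a (Phi_invariant).  The coefficient at x is
    computed without integration.  If c x = t, it is constant along the
    integrand.  If not, invariance of Haar measure under a character psi shows
    that psi(c x - t) fixes it, and it vanishes because characters separate the
    points of a discrete abelian group (char_separates).

    With these facts, a spectral M is invariant because the dual action
    preserves supports, and its parts M_t are spectral because the spectrum of
    M_t is that of M intersected with the fibre over t.  Conversely, by the
    approximation property, an invariant M is spectral as soon as it contains
    each f in C_c of the spectrum of M_t, for all t (spectral_criterion): an
    element supported in the spectrum of M is a limit of functions in C_c of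
    that spectrum, and each of them is a finite sum of its restrictions to the
    fibres of c.  If all M_t are spectral, these f belong to M by definition.
    If c^-1(0) is the unit space, the fibres of c are open bisections, and such
    an f is a finite sum of products a d with a in M_t and d a compactly
    supported function on the unit space (bisection_part). *)

Set Implicit Arguments.
Unset Strict Implicit.
Unset Printing Implicit Defensive.

Import Order.TTheory GRing.Theory Num.Theory.
Import numFieldNormedType.Exports.

Local Open Scope classical_set_scope.
Local Open Scope ring_scope.
Local Notation incl := Defs.incl.

(** * Real-valued norms of complex vectors *)

Section RNorm.
Context (R : realType).
Implicit Types (V : normedModType R[i]).

Lemma rnormE V (x : V) : `|x| = (rnorm x)%:C%C.
Proof.
have := normr_ge0 x; rewrite /rnorm; case: `|x| => a b /=.
by rewrite lecE /= => /andP[/eqP b0 _]; rewrite b0.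
Qed.

Lemma rnorm_ge0 V (x : V) : 0 <= rnorm x.
Proof. by have := normr_ge0 x; rewrite rnormE lecR. Qed.

Lemma rnorm0 V : rnorm (0 : V) = 0.
Proof. by rewrite /rnorm normr0. Qed.

Lemma rnorm_eq0 V (x : V) : rnorm x = 0 -> x = 0.
Proof. by move=> x0; apply/eqP; rewrite -normr_eq0 rnormE x0. Qed.

Lemma ler_rnormD V (x y : V) : rnorm (x + y) <= rnorm x + rnorm y.
Proof. by rewrite -lecR rmorphD /= -!rnormE ler_normD. Qed.

Lemma rnormN V (x : V) : rnorm (- x) = rnorm x.
Proof. by rewrite /rnorm normrN. Qed.

Lemma rnormBC V (x y : V) : rnorm (x - y) = rnorm (y - x).
Proof. by rewrite /rnorm distrC. Qed.

Lemma ler_rnormB V (x y z : V) : rnorm (x - z) <= rnorm (x - y) + rnorm (y - z).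
Proof. by have := ler_rnormD (x - y) (y - z); rewrite addrA subrK. Qed.

Lemma rnormZ V (k : R[i]) (x : V) : rnorm (k *: x) = rnorm (k : R[i]^o) * rnorm x.
Proof.
have := normrZ k x; rewrite !rnormE.
rewrite -rmorphM /=. by case.
Qed.

Lemma rnormM (k x : R[i]^o) : rnorm (k * x : R[i]^o) = rnorm k * rnorm x.
Proof. exact: rnormZ. Qed.

Lemma rnorm_real (r : R) : rnorm (r%:C%C : R[i]^o) = `|r|.
Proof. by rewrite /rnorm normc_def /= expr0n addr0 sqrtr_sqr. Qed.

Lemma Re_rnorm (z : R[i]^o) : `|complex.Re z| <= rnorm z.
Proof.
rewrite /rnorm normc_def /=; case: z => a b /=.
by rewrite -sqrtr_sqr ler_sqrt ?lerDl ?addr_ge0 ?sqr_ge0.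
Qed.

Lemma Im_rnorm (z : R[i]^o) : `|complex.Im z| <= rnorm z.
Proof.
rewrite /rnorm normc_def /=; case: z => a b /=.
by rewrite -sqrtr_sqr ler_sqrt ?lerDr ?addr_ge0 ?sqr_ge0.
Qed.

Lemma rnorm_ReIm (z : R[i]^o) : rnorm z <= `|complex.Re z| + `|complex.Im z|.
Proof.
rewrite /rnorm normc_def /=; case: z => a b /=.
rewrite -(@ler_pXn2r _ 2) ?nnegrE ?sqrtr_ge0 ?addr_ge0 //.
rewrite sqr_sqrtr ?addr_ge0 ?sqr_ge0 // sqrrD !real_normK ?num_real //.
by rewrite lerD2r lerDl mulrn_wge0 ?mulr_ge0.
Qed.

Lemma ler_rnorm_dist V (x y : V) : `|rnorm x - rnorm y| <= rnorm (x - y).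
Proof.
have := ler_rnormD (x - y) y; have := ler_rnormD (y - x) x.
rewrite !subrK (rnormBC y x) ler_norml => ? ?.
by apply/andP; split; lra.
Qed.

Lemma nbhs_rnormP V (x : V) (P : set V) :
  nbhs x P <-> exists2 e : R, 0 < e & forall y, rnorm (x - y) < e -> P y.
Proof.
rewrite -nbhs_ballE; split=> [[e /= e0 eP]|[e e0 eP]].
  have eE : e = (complex.Re e)%:C%C.
    by case: e e0 {eP} => a b; rewrite ltcE /= => /andP[/eqP -> _].
  exists (complex.Re e); first by rewrite -ltcR -eE.
  by move=> y xy; apply: eP; rewrite -ball_normE /ball_ /= rnormE eE ltcR.
exists e%:C%C; first by rewrite /= ltcR.
by move=> y; rewrite -ball_normE /ball_ /= rnormE ltcR => /eP.
Qed.

Lemma cvg_rnormP V (T : Type) (F : set_system T) (FF : Filter F) (f : T -> V) (x : V) :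
  f @ F --> x <-> forall e : R, 0 < e -> \forall t \near F, rnorm (x - f t) < e.
Proof.
split=> [Fx e e0|H].
  apply: (Fx (fun y => rnorm (x - y) < e)).
  by apply/nbhs_rnormP; exists e.
move=> P /nbhs_rnormP[e e0 eP].
by have := H _ e0; apply: filterS => t /eP.
Qed.

Lemma closure_rnormP V (E : set V) (x : V) :
  closure E x <-> forall e : R, 0 < e -> exists2 y, E y & rnorm (x - y) < e.
Proof.
split=> [cE e e0|H P /nbhs_rnormP[e e0 eP]].
  have [|y [Ey xy]] := cE (fun y => rnorm (x - y) < e).
    by apply/nbhs_rnormP; exists e.
  by exists y.
by have [y Ey xy] := H _ e0; exists y; split => //; exact: eP.
Qed.

Lemma cvg_rnorm V (T : Type) (F : set_system T) (FF : Filter F) (f : T -> V) (x : V) :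
  f @ F --> x -> rnorm (f t) @[t --> F] --> rnorm x.
Proof.
move=> /cvg_rnormP fx; apply/cvgrPdist_lt => e /fx; apply: filterS => t.
exact: le_lt_trans (ler_rnorm_dist _ _).
Qed.

End RNorm.

(** The same norm can occur with different inferred additive structures inside
    its argument; it is abstracted up to conversion before linear arithmetic. *)
Ltac rnorm_lra :=
  repeat match goal with H : context [rnorm _] |- _ => move: H end;
  repeat (match goal with |- context [@rnorm ?R ?V ?x] =>
    let r := fresh "r" in set r := (@rnorm R V x); move: r => r end);
  intros; lra.

Section Limits.
Context (R : realType).

Definition inv_succ (n : nat) : R := n.+1%:R^-1.

Lemma inv_succ_gt0 n : 0 < inv_succ n.
Proof. by rewrite invr_gt0 ltr0n. Qed.

Lemma ler_eps (x y : R) : (forall e : R, 0 < e -> x <= y + e) -> x <= y.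
Proof. by move=> H; apply/ler_addgt0Pr. Qed.

Lemma rnorm_le0 (V : normedModType R[i]) (x : V) :
  (forall e : R, 0 < e -> rnorm x <= e) -> x = 0.
Proof.
move=> H; apply: rnorm_eq0; apply/eqP; rewrite eq_le rnorm_ge0 andbT.
by apply: ler_eps => e /H; rewrite add0r.
Qed.

Lemma near_inv_nat (e : R) : 0 < e -> \forall n \near \oo, inv_succ n < e.
Proof. by move=> e0; exact: near_infty_natSinv_lt (PosNum e0). Qed.

Lemma rcauchy_cvg (V : completeNormedModType R[i]) (u : nat -> V) :
  (forall n m, rnorm (u n - u m) <= inv_succ n + inv_succ m) ->
  exists x : V, u @ \oo --> x.
Proof.
move=> H; suff : cvg (u @ \oo) by exists (lim (u @ \oo)).
apply/cauchy_cvgP; apply/cauchyP => e e0.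
have [d d0 ed] : exists2 d : R, 0 < d & e = (d + d)%:C%C.
  exists (complex.Re e / 2).
    by case: e e0 => a b; rewrite /= ltcE /= => /andP[_ a0]; rewrite divr_gt0.
  by case: e e0 => a b; rewrite /= ltcE /= => /andP[/eqP -> _]; congr (_ +i* _)%C; lra.
have [N _ HN] := near_inv_nat d0.
exists (u N); suff : \forall n \near \oo, ball (u N) e (u n) by [].
near=> n.
rewrite -ball_normE /ball_ /= rnormE ed ltcR (le_lt_trans (H _ _)) //.
apply: ltrD; first exact: HN N (leqnn N).
by near: n; exact: near_inv_nat.
Unshelve. all: by end_near. Qed.

Lemma rcauchy_cvg_real (u : nat -> R) :
  (forall n m, `|u n - u m| <= inv_succ n + inv_succ m) ->
  exists x : R, u @ \oo --> x.
Proof.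
move=> H; suff : cvg (u @ \oo) by exists (lim (u @ \oo)).
apply/cauchy_cvgP; apply/cauchyP => e e0.
have d0 : 0 < e / 2 by rewrite divr_gt0.
have [N _ HN] := near_inv_nat d0.
exists (u N); suff : \forall n \near \oo, ball (u N) e (u n) by [].
near=> n.
rewrite -ball_normE /ball_ /= (le_lt_trans (H _ _)) // [ltRHS]splitr.
apply: ltrD; first exact: HN N (leqnn N).
by near: n; exact: near_inv_nat.
Unshelve. all: by end_near. Qed.

(** R[i] is complete since the real and imaginary parts of a Cauchy sequence are
    Cauchy. *)
Lemma rcauchy_cvg_complex (u : nat -> R[i]^o) :
  (forall n m, rnorm (u n - u m) <= inv_succ n + inv_succ m) ->
  exists x : R[i]^o, u @ \oo --> x.
Proof.
move=> H.
have [|a ua] := rcauchy_cvg_real (u := fun n => complex.Re (u n)).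
  move=> n m; apply: le_trans (H n m); apply: le_trans (Re_rnorm _).
  by case: (u n) (u m) => ? ? [? ?].
have [|b ub] := rcauchy_cvg_real (u := fun n => complex.Im (u n)).
  move=> n m; apply: le_trans (H n m); apply: le_trans (Im_rnorm _).
  by case: (u n) (u m) => ? ? [? ?].
exists (a +i* b)%C; apply/cvg_rnormP => e e0.
have d0 : 0 < e / 2 by rewrite divr_gt0.
near=> n.
apply: (le_lt_trans (rnorm_ReIm _)); rewrite [ltRHS]splitr; apply: ltrD.
  have : `|a - complex.Re (u n)| < e / 2.
    by near: n; move/cvgrPdist_lt: ua; apply.
  by case: (u n).
have : `|b - complex.Im (u n)| < e / 2.
  by near: n; move/cvgrPdist_lt: ub; apply.
by case: (u n).
Unshelve. all: by end_near. Qed.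

End Limits.

(** * The reduced norm *)

Section GroupoidBasics.
Context (G : Type) (S : groupoid G).

Lemma unit_rng u : unit_space S u -> rng S u = u.
Proof. by case=> x _ <-; rewrite rng_src. Qed.

Lemma unit_src u : unit_space S u -> src S u = u.
Proof. by case=> x _ <-; rewrite src_src. Qed.

Lemma unit_inv u : unit_space S u -> ginv S u = u.
Proof.
move=> uU; rewrite -[LHS](mul_src S) src_inv unit_rng //.
by rewrite mul_inv_l unit_src.
Qed.

Lemma src_unit x : unit_space S (src S x).
Proof. by exists x. Qed.

Lemma mul_inv_src x : gmul S x (ginv S (src S x)) = x.
Proof. by rewrite unit_inv ?mul_src //; exact: src_unit. Qed.

Context (Gamma : zmodType) (c : G -> Gamma).
Context (cM : forall x y, src S x = rng S y -> c (gmul S x y) = c x + c y).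

Lemma cocycle_unit u : unit_space S u -> c u = 0.
Proof.
move=> uU; have := cM (x := u) (y := u).
rewrite unit_src // unit_rng // => /(_ erefl).
rewrite -{2}(unit_src uU) mul_src => /eqP.
by rewrite -{1}[c u]addr0 => /eqP/addrI.
Qed.

Lemma cocycle_inv x : c (ginv S x) = - c x.
Proof.
apply/eqP; rewrite -addr_eq0; apply/eqP.
by rewrite -cM ?src_inv // mul_inv_l cocycle_unit //; exact: src_unit.
Qed.

Lemma cocycle_div x y : src S x = src S y -> c (gmul S x (ginv S y)) = c x - c y.
Proof. by move=> xy; rewrite cM ?rng_inv // cocycle_inv. Qed.

End GroupoidBasics.

Section RedNorm.
Context (R : realType) (G : topologicalType) (S : groupoid G).
Local Notation C := (R[i]^o).
Implicit Types (f g xi : G -> C).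

Lemma l2norm_le u xi (e : R) : 0 <= e ->
  (l2norm S u xi <= e%:E)%E <->
  forall X, fsets (src_fiber S u) X -> \sum_(x \in X) rnorm (xi x) ^+ 2 <= e ^+ 2.
Proof.
move=> e0; have -> : e%:E = sqrte (e ^+ 2)%:E.
  by rewrite /= sqrtr_sqr ger0_norm.
rewrite /l2norm lee_sqrt ?lee_fin ?sqr_ge0 //.
have sumE X : finite_set X ->
    (\sum_(x \in X) (rnorm (xi x) ^+ 2)%:E = (\sum_(x \in X) rnorm (xi x) ^+ 2)%:E)%E.
  by move=> fX; rewrite -fsumEFin.
split=> [le X [fX XS]|H].
  rewrite -lee_fin -sumE //; apply: le_trans le.
  by apply: ereal_sup_ubound; exists X.
apply: ge_ereal_sup => _ [X [fX XS] <-].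
by rewrite sumE // lee_fin; apply: H.
Qed.

Lemma le_l2norm u xi zeta :
  (forall x, src_fiber S u x -> rnorm (xi x) <= rnorm (zeta x)) ->
  (l2norm S u xi <= l2norm S u zeta)%E.
Proof.
move=> H; rewrite /l2norm lee_sqrt.
  by apply: le_esum => x /H xz; rewrite lee_fin lerXn2r ?nnegrE ?rnorm_ge0.
by apply: esum_ge0 => x _; rewrite lee_fin sqr_ge0.
Qed.

Lemma red_norm_le f (e : R) : 0 <= e ->
  (red_norm S f <= e%:E)%E <->
  forall u xi, unit_space S u -> (l2norm S u xi <= 1)%E ->
    (l2norm S u (Ind S u f xi) <= e%:E)%E.
Proof.
move=> e0; split=> [le u xi uU xi1|H].
  apply: le_trans le; apply: (@le_trans _ _ (Ind_norm S u f)).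
    by apply: ereal_sup_ubound; exists xi.
  by apply: ereal_sup_ubound; right; exists u.
apply: ge_ereal_sup => _ [->|[u uU <-]]; first by rewrite lee_fin.
by apply: ge_ereal_sup => _ [xi /= xi1 <-]; apply: H.
Qed.

(** Ind_u(f) maps the delta function at the unit u = s(x) to a vector whose
    x-coordinate is f(x). *)
Lemma coef_le_red_norm f x (e : R) : 0 <= e ->
  (red_norm S f <= e%:E)%E -> rnorm (f x) <= e.
Proof.
move=> e0 /(red_norm_le _ e0) H.
pose delta (y : G) : C := (y == src S x)%:R.
have /(H _ delta): unit_space S (src S x) by exact: src_unit.
have delta0 y : y != src S x -> delta y = 0 by rewrite /delta => /negbTE ->.
have delta1 : delta (src S x) = 1 by rewrite /delta eqxx.
have /[swap]/[apply] : (l2norm S (src S x) delta <= 1)%E.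
  apply/(l2norm_le _ _ ler01) => X [fX XS]; rewrite expr1n.
  have [xX|xX] := pselect (X (src S x)).
    rewrite (fsbigD1 (src S x)) //= delta1 fsbig1 ?addr0 => [|y [_ /eqP yx]].
      by rewrite /rnorm normr1 /= expr1n.
    by rewrite delta0 // rnorm0 expr0n.
  rewrite fsbig1 ?ler01 // => y Xy; rewrite delta0 ?rnorm0 ?expr0n //.
  by apply/eqP => yx; apply: xX; rewrite -yx.
move=> /(l2norm_le _ _ e0) /(_ [set x]).
rewrite fsbig_set1 => /(_ _)/wrap[].
  by split=> // _ ->.
rewrite ler_pXn2r ?nnegrE ?rnorm_ge0 //; congr (is_true (rnorm _ <= _)).
rewrite /Ind -(@fsbig_widen _ _ _ _ [set src S x]) ?fsbig_set1.
- by rewrite delta1 mulr1 mul_inv_src.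
- by move=> _ ->; rewrite /src_fiber /= src_src.
- by move=> y [_ /= /eqP yx]; rewrite delta0 // mulr0.
Qed.

(** A unimodular function that is multiplicative along source fibres, such as a
    character of a cocycle, conjugates every Ind_u by a diagonal unitary. *)
Lemma red_norm_phase (p : G -> C) f (e : R) : 0 <= e ->
  (forall x, rnorm (p x) = 1) ->
  (forall x y, src S x = src S y -> p (gmul S x (ginv S y)) = p x * (p y)^-1) ->
  (red_norm S f <= e%:E)%E -> (red_norm S (fun x => p x * f x)%R <= e%:E)%E.
Proof.
move=> e0 p1 pdiv /(red_norm_le _ e0) H; apply/(red_norm_le _ e0) => u xi uU xi1.
have p0 y : p y != 0.
  by apply/eqP => py; have := p1 y; rewrite py rnorm0 => /esym/eqP; rewrite oner_eq0.
have pV y : rnorm ((p y)^-1 : C) = 1.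
  by have := rnormM (p y) (p y)^-1; rewrite divff // p1 mul1r /rnorm normr1 => <-.
pose zeta y : C := (p y)^-1 * xi y.
have /(H _ _ uU) : (l2norm S u zeta <= 1)%E.
  by apply: le_trans xi1; apply: le_l2norm => x _; rewrite rnormM pV mul1r.
apply: le_trans; apply: le_l2norm => x xu; rewrite -[leRHS]mul1r -(p1 x) -rnormM.
rewrite /Ind mulr_fsumr; rewrite le_eqVlt; apply/orP; left; apply/eqP.
congr rnorm; apply: eq_fsbigr => y; rewrite inE => yu.
by rewrite pdiv ?xu ?yu // /zeta; ring.
Qed.

(** This is the injectivity of the coefficient map on the level of functions:
    Ind_u(f) is tested on finitely supported vectors and on finitely many
    coordinates, and there only finitely many values of f - g_m enter, which
    tend to those of f. *)
Lemma red_norm_lim f (g : nat -> G -> C) (e : R) : 0 <= e ->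
  (forall m, (red_norm S (fun x => f x - g m x)%R <= e%:E)%E) ->
  (forall x, g m x @[m --> \oo] --> (0 : C)) ->
  (red_norm S f <= e%:E)%E.
Proof.
move=> e0 He g0; apply/(red_norm_le _ e0) => u xi uU xi1.
apply/(l2norm_le _ _ e0) => X [fX XS].
(* The sum that defines Ind_u(f) xi at x is 0 by convention when infinitely many
   terms are nonzero, so only the coordinates with a finite T x contribute. *)
pose T x := src_fiber S u `&`
  (fun y => f (gmul S x (ginv S y)) * xi y) @^-1` [set~ 0].
pose Y := \bigcup_(x in X `&` [set x | finite_set (T x)]) T x.
have fY : finite_set Y.
  by apply: bigcup_finite => [|x [_]]//; apply: finite_setIl.
have YS : Y `<=` src_fiber S u by move=> y [x _ []].
pose zeta y : C := if y \in Y then xi y else 0.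
have zeta1 : (l2norm S u zeta <= 1)%E.
  apply: le_trans xi1; apply: le_l2norm => y _; rewrite /zeta.
  by case: ifP => // _; rewrite rnorm0 rnorm_ge0.
have IndY h x : Ind S u h zeta x = \sum_(y \in Y) h (gmul S x (ginv S y)) * zeta y.
  symmetry; apply: fsbig_widen => // y [_ yY]; rewrite /= /zeta.
  by case: ifPn => [/set_mem//|_]; rewrite mulr0.
have le_zeta x : X x -> rnorm (Ind S u f xi x) <= rnorm (Ind S u f zeta x).
  move=> Xx; have [fT|iT] := pselect (finite_set (T x)); last first.
    have -> : Ind S u f xi x = 0 by exact: fsbig_dflt.
    by rewrite rnorm0 rnorm_ge0.
  rewrite IndY /Ind le_eqVlt; apply/orP; left; apply/eqP; congr rnorm.
  transitivity (\sum_(y \in Y) f (gmul S x (ginv S y)) * xi y).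
    symmetry; apply: fsbig_widen => // y [yS yY]; apply: contra_notP yY => y0.
    by exists x.
  by apply: eq_fsbigr => y yY; rewrite /zeta yY.
apply: (@le_trans _ _ (\sum_(x \in X) rnorm (Ind S u f zeta x) ^+ 2)).
  rewrite !fsbig_finite //= big_seq [leRHS]big_seq; apply: ler_sum => x.
  rewrite in_fset_set // => /set_mem /le_zeta.
  by move=> ?; rewrite ler_pXn2r ?nnegrE ?rnorm_ge0.
have cvgI x : rnorm (Ind S u (fun y => f y - g m y) zeta x) @[m --> \oo] -->
    rnorm (Ind S u f zeta x).
  apply: cvg_rnorm.
  have -> : (fun m => Ind S u (fun y => f y - g m y) zeta x) =
      (fun m => \sum_(y <- fset_set Y)
        (f (gmul S x (ginv S y)) - g m (gmul S x (ginv S y))) * zeta y).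
    by apply/funext => m; rewrite IndY fsbig_finite.
  rewrite IndY fsbig_finite //=; apply: cvg_big => [|y _].
    exact: add_continuous.
  apply: cvgMr_tmp; rewrite -[X in _ --> X]subr0.
  by apply: cvgB; [exact: cvg_cst|exact: g0].
rewrite fsbig_finite //=.
have : \sum_(x <- fset_set X) rnorm (Ind S u (fun y => f y - g m y) zeta x) ^+ 2
    @[m --> \oo] --> \sum_(x <- fset_set X) rnorm (Ind S u f zeta x) ^+ 2.
  apply: cvg_big => [|y _]; first exact: add_continuous.
  by rewrite expr2; apply: cvgM; exact: cvgI.
apply: (@closed_cvg _ _ _ _ _ (fun r : R => r <= e ^+ 2)); first exact: closed_le.
apply: nearW => m; rewrite -fsbig_finite //.
have /(red_norm_le _ e0) /(_ _ _ uU zeta1) /(l2norm_le _ _ e0) := He m.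
by apply.
Qed.

End RedNorm.

(** * Existence of the Fourier coefficients *)

Section CompactSupport.
Context (R : realType) (G : topologicalType).
Local Notation C := (R[i]^o).
Implicit Types (f g : G -> C) (P : set G).

Lemma Cc_lin P k f g : Cc P f -> Cc P g -> Cc P (k *: f + g).
Proof.
move=> [cf kf sf] [cg kg sg].
have sub : closure [set x | (k *: f + g) x != 0] `<=`
    closure [set x | f x != 0] `|` closure [set x | g x != 0].
  rewrite -closureU; apply: closureS => x /= kfg.
  have [fx|fx] := eqVneq (f x) 0; last by left.
  right; move: kfg; apply: contra_neq => gx.
  by rewrite /GRing.add /= /GRing.scale /= fx gx scaler0 addr0.
split.
- move=> x; apply: cvgD; last exact: cg.
  by apply: cvgZl_tmp; exact: cf.
- by apply: subclosed_compact sub; [exact: closed_closure|exact: compactU].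
- by move=> x /sub[/sf|/sg].
Qed.

Lemma Cc_supp P f g : Cc P f -> continuous g -> (forall x, f x = 0 -> g x = 0) ->
  Cc P g.
Proof.
move=> [cf kf sf] cg fg.
have sub : closure [set x | g x != 0] `<=` closure [set x | f x != 0].
  by apply: closureS => x /=; apply: contra_neq => /fg.
split=> //; last by move=> x /sub/sf.
by apply: subclosed_compact sub; first exact: closed_closure.
Qed.

Lemma Cc_compact P f K : hausdorff_space G -> continuous f -> compact K ->
  K `<=` P -> (forall x, ~ K x -> f x = 0) -> Cc P f.
Proof.
move=> hG cf cK KP fK.
have sub : closure [set x | f x != 0] `<=` K.
  rewrite [X in _ `<=` X](closure_id K).1; last exact: compact_closed.
  by apply: closureS => x /= /eqP; apply: contra_notP => /fK.
split=> //; last by move=> x /sub/KP.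
by apply: subclosed_compact sub; first exact: closed_closure.
Qed.

Lemma eq0_off_support f x : ~ closure [set y | f y != 0] x -> f x = 0.
Proof.
by move=> fx; apply/eqP; apply: contra_notT fx; exact: (@subset_closure _ [set y | f y != 0] x).
Qed.

Lemma Cc_eq0 P f x : Cc P f -> ~ P x -> f x = 0.
Proof. by move=> [_ _ sf] Px; apply: eq0_off_support => /sf. Qed.

Lemma Cc_sub P Q f : P `<=` Q -> Cc P f -> Cc Q f.
Proof. by move=> PQ [cf kf sf]; split=> // x /sf/PQ. Qed.

Lemma Cc_setT P f : Cc P f -> Cc setT f.
Proof. exact: Cc_sub. Qed.

Lemma Cc0 P : Cc P (0 : G -> C).
Proof.
have E : [set x | (0 : G -> C) x != 0] = set0.
  by apply/seteqP; split=> x //=; rewrite eqxx.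
by split; rewrite ?E ?closure0; [exact: cst_continuous|exact: compact0|].
Qed.

End CompactSupport.

Section FourierCoef.
Context (R : realType) (G : topologicalType) (S : groupoid G).
Context (A : reduced_algebra R S).
Local Notation C := (R[i]^o).
Implicit Types (f g : G -> C) (a b : A).

Lemma incl_sub f g : Cc setT f -> Cc setT g -> incl A (f - g) = incl A f - incl A g.
Proof.
move=> cf cg; have := incl_linear A (-1) cg cf.
by rewrite !scaleN1r addrC => ->; rewrite addrC.
Qed.

Lemma Cc_subr P f g : Cc P f -> Cc P g -> Cc P (f - g).
Proof. by move=> cf cg; have := Cc_lin (-1) cg cf; rewrite scaleN1r addrC. Qed.

Lemma coef_le_incl f x : Cc setT f -> rnorm (f x) <= rnorm (incl A f).
Proof.
by move=> cf; apply: (coef_le_red_norm (S := S) x (rnorm_ge0 _)); rewrite -(incl_norm A).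
Qed.

Lemma incl_approx a (e : R) : 0 < e ->
  exists2 f, Cc setT f & rnorm (a - incl A f) < e.
Proof.
move=> e0; have : closure (incl A @` Cc setT) a by rewrite incl_dense.
by move=> /closure_rnormP /(_ _ e0)[_ [f cf <-] af]; exists f.
Qed.

Definition approx_seq a (n : nat) : G -> C :=
  xget (fun=> 0) [set f | Cc setT f /\ rnorm (a - incl A f) < inv_succ R n].

Lemma approx_seqP a n : Cc setT (approx_seq a n) /\
  rnorm (a - incl A (approx_seq a n)) < inv_succ R n.
Proof.
have [f cf af] := incl_approx a (inv_succ_gt0 R n).
have : exists f, [set f | Cc setT f /\ rnorm (a - incl A f) < inv_succ R n] f.
  by exists f.
by move=> /(xgetPex (fun=> 0)).
Qed.

Lemma approx_seq_dist a n m :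
  rnorm (incl A (approx_seq a n) - incl A (approx_seq a m)) <=
  inv_succ R n + inv_succ R m.
Proof.
apply: le_trans (ler_rnormB _ a _) _; rewrite rnormBC.
by apply: lerD; exact: ltW (approx_seqP _ _).2.
Qed.

(** The evaluation at x is a contraction on the dense subspace C_c(G), and so
    it extends to the whole algebra. *)
Lemma coef_exists a x : exists z : C,
  forall f, Cc setT f -> rnorm (z - f x) <= rnorm (a - incl A f).
Proof.
have [n m|z uz] := @rcauchy_cvg_complex R (fun n => approx_seq a n x).
  have [cn _] := approx_seqP a n; have [cm _] := approx_seqP a m.
  apply: le_trans (approx_seq_dist a n m).
  by rewrite -incl_sub //; exact: (coef_le_incl x (Cc_subr cn cm)).
exists z => f cf; apply: ler_eps => e e0.
have e2 : 0 < e / 2 by rewrite divr_gt0.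
move/cvg_rnormP: (uz) => /(_ _ e2) zu.
have [n [zn en]] : exists n, rnorm (z - approx_seq a n x) < e / 2 /\ inv_succ R n < e / 2.
  exact: filter_ex (filterI zu (near_inv_nat e2)).
have [cn an] := approx_seqP a n.
apply: le_trans (ler_rnormB _ (approx_seq a n x) _) _.
have := coef_le_incl x (Cc_subr cn cf); rewrite incl_sub //.
have := ler_rnormB (incl A (approx_seq a n)) a (incl A f).
rewrite (rnormBC _ a).
have -> : (approx_seq a n - f) x = approx_seq a n x - f x by [].
rnorm_lra.
Qed.

Lemma coef_unique a x (z w : C) :
  (forall f, Cc setT f -> rnorm (z - f x) <= rnorm (a - incl A f)) ->
  (forall f, Cc setT f -> rnorm (w - f x) <= rnorm (a - incl A f)) -> z = w.
Proof.
move=> zP wP; apply/eqP; rewrite -subr_eq0; apply/eqP; apply: rnorm_eq0.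
apply/eqP; rewrite eq_le rnorm_ge0 andbT; apply: ler_eps => e e0.
have e2 : 0 < e / 2 by rewrite divr_gt0.
have [f cf af] := incl_approx a e2.
have := ler_rnormB z (f x) w; have := zP f cf; have := wP f cf.
by rewrite (rnormBC (f x) w); rnorm_lra.
Qed.

Lemma extends_inclusion_exists : exists j, extends_inclusion (A := A) j.
Proof.
pose j a x : C := xget 0 [set z : C |
  forall f, Cc setT f -> rnorm (z - f x) <= rnorm (a - incl A f)].
have jP a x f : Cc setT f -> rnorm (j a x - f x) <= rnorm (a - incl A f).
  by move: f; have /(xgetPex 0) := coef_exists a x.
have j_incl f : Cc setT f -> j (incl A f) = f.
  move=> cf; apply/funext => x; apply/eqP; rewrite -subr_eq0; apply/eqP.
  apply: rnorm_eq0; apply/eqP; rewrite eq_le rnorm_ge0 andbT.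
  by have := jP (incl A f) x f cf; rewrite subrr rnorm0.
have incl0 : incl A 0 = 0.
  by have := incl_sub (@Cc0 R G setT) (@Cc0 R G setT); rewrite !subrr.
exists j; split=> [k a b|a|a x|//].
- apply/funext => x; apply: (@coef_unique (k *: a + b) x); first exact: jP.
  move=> f cf; apply: ler_eps => e e0.
  (* Replacing a and b by functions at distance d costs at most 2 (|k| + 1) d = e. *)
  have k1 : 0 < (rnorm (k : C) + 1) * 2.
    by rewrite mulr_gt0 // ltr_wpDl ?rnorm_ge0.
  pose d := e / ((rnorm (k : C) + 1) * 2).
  have d0 : 0 < d by rewrite divr_gt0.
  have dE : (rnorm (k : C) + 1) * 2 * d = e by rewrite mulrC divfK // gt_eqF.
  have [g cg ag] := incl_approx a d0; have [h ch bh] := incl_approx b d0.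
  have ckgh := Cc_lin k cg ch.
  have := coef_le_incl x (Cc_subr ckgh cf); rewrite incl_sub // incl_linear //.
  have -> : (k *: g + h - f) x = k * g x + h x - f x by [].
  have -> : (k *: j a + j b) x - f x =
      k * (j a x - g x) + ((j b x - h x) + (k * g x + h x - f x)) :> C.
    have -> : (k *: j a + j b) x = k * j a x + j b x by [].
    by ring.
  have -> : k *: incl A g + incl A h - incl A f =
      (k *: (incl A g - a) + (incl A h - b)) + (k *: a + b - incl A f).
    by rewrite scalerBr (addrACA (k *: incl A g)) -opprD addrA subrK.
  have := ler_rnormD (k * (j a x - g x) : C) ((j b x - h x) + (k * g x + h x - f x)).
  have := ler_rnormD (j b x - h x) (k * g x + h x - f x).
  have := ler_rnormD (k *: (incl A g - a) + (incl A h - b)) (k *: a + b - incl A f).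
  have := ler_rnormD (k *: (incl A g - a)) (incl A h - b).
  have := jP a x g cg; have := jP b x h ch.
  rewrite rnormM rnormZ (rnormBC _ a) (rnormBC _ b).
  have k0 := rnorm_ge0 (k : C).
  have da : rnorm (k : C) * rnorm (a - incl A g) <= rnorm (k : C) * d.
    by apply: ler_wpM2l => //; exact: ltW.
  move=> jb ja; have dj := ler_wpM2l k0 ja; move: dj.
  have dE' : rnorm (k : C) * d * 2 + d * 2 = e by rewrite -dE; ring.
  rnorm_lra.
- split=> [|x|e e0]; last 2 first.
  - by move=> /(_ I).
  - have [f cf af] := incl_approx a e0; have [_ kf _] := cf.
    exists (closure [set x | f x != 0]) => // x _ fx.
    by have := jP a x f cf; rewrite (eq0_off_support fx) subr0; rnorm_lra.
  - apply: continuous_subspaceT => x; apply/cvg_rnormP => e e0.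
    have e3 : 0 < e / 3 by rewrite divr_gt0.
    have [f [cf kf sf] af] := incl_approx a e3.
    have /cvg_rnormP /(_ _ e3) := cf x; apply: filterS => y fxy.
    have := jP a x f (And3 cf kf sf); have := jP a y f (And3 cf kf sf).
    have := ler_rnormB (j a x) (f x) (j a y); have := ler_rnormB (f x) (f y) (j a y).
    by rewrite (rnormBC (f y)); rnorm_lra.
- by have := jP a x 0 (@Cc0 _ _ _); rewrite incl0 !subr0.
Qed.

Lemma fourier_coefP : extends_inclusion (fourier_coef (A := A)).
Proof. exact: xgetPex extends_inclusion_exists. Qed.

End FourierCoef.

(** * Injectivity of the coefficient map and multiplication by phases *)

Section CoefTheory.
Context (R : realType) (G : topologicalType) (S : groupoid G).
Context (A : reduced_algebra R S).
Local Notation C := (R[i]^o).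
Local Notation j := (fourier_coef (A := A)).
Implicit Types (f g : G -> C) (a b : A).

Lemma fourier_lin k a b x : j (k *: a + b) x = k * j a x + j b x :> C.
Proof. by have [-> _ _ _] := fourier_coefP A. Qed.

Lemma fourier_C0 a : C0 setT (j a).
Proof. by have [_ + _ _] := fourier_coefP A. Qed.

Lemma fourier_continuous a : continuous (j a).
Proof. by apply/continuous_subspace_setT; have [] := fourier_C0 a. Qed.

Lemma fourier_norm a x : rnorm (j a x) <= rnorm a.
Proof. by have [_ _ + _] := fourier_coefP A. Qed.

Lemma fourier_incl f : Cc setT f -> j (incl A f) = f.
Proof. by have [_ _ _] := fourier_coefP A; apply. Qed.

Lemma fourier0 x : j 0 x = 0.
Proof. by apply: rnorm_le0 => e e0; rewrite (le_trans (fourier_norm 0 x)) // rnorm0 ltW. Qed.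

Lemma fourierZ k a x : j (k *: a) x = k * j a x :> C.
Proof. by rewrite -[k *: a]addr0 fourier_lin fourier0 addr0. Qed.

Lemma fourierD a b x : j (a + b) x = j a x + j b x :> C.
Proof. by rewrite -[a]scale1r fourier_lin mul1r scale1r. Qed.

Lemma fourierB a b x : j (a - b) x = j a x - j b x :> C.
Proof. by rewrite addrC -scaleN1r fourier_lin mulN1r addrC. Qed.

(** A C_c(G)-approximation of an element with zero coefficients tends to 0
    pointwise while staying Cauchy in reduced norm, hence tends to 0 in norm. *)
Lemma fourier_inj a b : (forall x, j a x = j b x) -> a = b.
Proof.
move=> ab; apply/eqP; rewrite -subr_eq0; apply/eqP.
have {ab} : forall x, j (a - b) x = 0 by move=> x; rewrite fourierB ab subrr.
move: (a - b) => {}a a0; apply: rnorm_le0 => e e0.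
have e3 : 0 < e / 3 by rewrite divr_gt0.
have [N _ HN] := near_inv_nat e3.
pose f n := approx_seq a n.
have fP n : Cc setT (f n) := (approx_seqP a n).1.
have fx n x : rnorm (f n x) <= inv_succ R n.
  have := fourier_norm (a - incl A (f n)) x.
  rewrite fourierB a0 sub0r rnormN fourier_incl // => /le_trans; apply.
  exact: ltW (approx_seqP a n).2.
suff H : rnorm (incl A (f N)) <= e / 3 + e / 3.
  have := ler_rnormB a (incl A (f N)) 0; have := (approx_seqP a N).2.
  have := HN N (leqnn N); rewrite !subr0 /= -/(f N); rnorm_lra.
rewrite -lee_fin incl_norm //.
apply: (@red_norm_lim _ _ _ _ (fun m => f (m + N)%N)); first by rewrite addr_ge0 // ltW.
  move=> m; rewrite -[X in red_norm _ X]/(f N - f (m + N)%N) -(incl_norm A); last exact: Cc_subr.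
  rewrite incl_sub // lee_fin (le_trans (approx_seq_dist _ _ _)) // lerD //.
    by apply: ltW; apply: (HN N (leqnn N)).
  by apply: ltW; apply: (HN (m + N)%N) => /=; rewrite leq_addl.
move=> x; apply/cvg_rnormP => d d0.
have [M _ HM] := near_inv_nat d0.
exists M => //= m Mm; rewrite sub0r rnormN (le_lt_trans (fx _ _)) //.
by apply: HM => /=; rewrite (leq_trans Mm) ?leq_addr.
Qed.

Lemma incl_cvg_coef a (f : nat -> G -> C) x : (forall n, Cc setT (f n)) ->
  incl A (f n) @[n --> \oo] --> a -> f n x @[n --> \oo] --> (j a x : C).
Proof.
move=> cf /cvg_rnormP fa; apply/cvg_rnormP => e /fa; apply: filterS => n.
have := fourier_norm (a - incl A (f n)) x; rewrite fourierB fourier_incl //.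
exact: le_lt_trans.
Qed.

(** Multiplication by such a phase and by its inverse are contractive on C_c(G),
    and so it extends to the whole algebra by completeness. *)
Lemma phase_mul (p : G -> C) a : continuous p -> (forall x, rnorm (p x) = 1) ->
  (forall x y, src S x = src S y -> p (gmul S x (ginv S y)) = p x * (p y)^-1) ->
  exists2 b, rnorm b <= rnorm a & forall x, j b x = p x * j a x :> C.
Proof.
move=> cp p1 pdiv.
pose f n := approx_seq a n.
have fP n : Cc setT (f n) := (approx_seqP a n).1.
pose m (g : G -> C) x : C := p x * g x.
have mP g : Cc setT g -> Cc setT (m g).
  move=> cg; apply: (Cc_supp cg); last by move=> x gx; rewrite /m gx mulr0.
  by move=> x; apply: cvgM; [exact: cp|case: cg => cg _ _; exact: cg].
have m_norm g : Cc setT g -> rnorm (incl A (m g)) <= rnorm (incl A g).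
  move=> cg; rewrite -lee_fin incl_norm; last exact: mP.
  by apply: red_norm_phase => //; rewrite ?rnorm_ge0 // -(incl_norm A).
have mB g h : m g - m h = m (g - h).
  by apply/funext => x; exact: esym (mulrBr (p x) (g x) (h x)).
have [|b mb] := @rcauchy_cvg R A (fun n => incl A (m (f n))).
  move=> n k; rewrite -incl_sub ?mB; try exact: mP.
  apply: le_trans (approx_seq_dist a n k).
  by rewrite -incl_sub //; apply: m_norm; exact: Cc_subr.
exists b.
  apply: ler_eps => e e0; have e2 : 0 < e / 2 by rewrite divr_gt0.
  move/cvg_rnormP: (mb) => /(_ _ e2) bn.
  have [n [bn1 en]] := filter_ex (filterI bn (near_inv_nat e2)).
  have := m_norm _ (fP n); have := (approx_seqP a n).2; rewrite -/(f n).
  have := ler_rnormB b (incl A (m (f n))) 0.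
  have := ler_rnormB (incl A (f n)) a 0.
  by rewrite !subr0 (rnormBC _ a); rnorm_lra.
move=> x.
have := incl_cvg_coef (x := x) (fun n => mP _ (fP n)) mb.
have fa : incl A (f n) @[n --> \oo] --> a.
  apply/cvg_rnormP => e e0.
  have := near_inv_nat e0; apply: filterS => n; apply: lt_trans.
  exact: (approx_seqP a n).2.
have fx := incl_cvg_coef (x := x) fP fa.
have px : m (f n) x @[n --> \oo] --> (p x * j a x : C) by exact: cvgMl_tmp.
move=> bx; apply: (cvg_unique _ bx px); exact: norm_hausdorff.
Qed.

End CoefTheory.

(** * Characters, cocycles and the dual action *)

Section Characters.
Context (R : realType) (Gamma : zmodType).
Local Notation C := (R[i]^o).
Implicit Types chi psi : dual_group R Gamma.

Lemma char_valD chi s t : char_val chi (s + t) = char_val chi s * char_val chi t.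
Proof. by have [+ _] := set_mem (valP chi); apply. Qed.

Lemma char_val_norm chi t : rnorm (char_val chi t) = 1.
Proof. by have [_ chi1] := set_mem (valP chi); rewrite /rnorm chi1. Qed.

Lemma char_val_neq0 chi t : char_val chi t != 0.
Proof.
apply/eqP => chi0; have := char_val_norm chi t.
by rewrite chi0 rnorm0 => /esym/eqP; rewrite oner_eq0.
Qed.

Lemma char_val0 chi : char_val chi 0 = 1.
Proof.
apply: (mulfI (char_val_neq0 chi 0)).
by rewrite -char_valD addr0 mulr1.
Qed.

Lemma char_valN chi t : char_val chi (- t) = (char_val chi t)^-1.
Proof.
apply: (mulfI (char_val_neq0 chi t)).
by rewrite -char_valD subrr char_val0 divff ?char_val_neq0.
Qed.

Lemma conjc_char chi t : (char_val chi t)^*%C = (char_val chi t)^-1.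
Proof.
have [_ chi1] := set_mem (valP chi).
rewrite -[RHS]mul1r; apply: canRL (mulfK (char_val_neq0 _ _)) _.
by rewrite mulrC -[LHS]sqr_normc -/(`|_|) chi1 expr1n.
Qed.

Lemma charV_subproof chi : (fun t => (char_val chi t)^-1) \in @characters R Gamma.
Proof.
have [chiD chi1] := set_mem (valP chi).
rewrite inE; split=> [s t|t]; first by rewrite char_valD invfM.
by rewrite normfV /char_val chi1 invr1.
Qed.

Definition charV chi : dual_group R Gamma :=
  exist (fun f => f \in @characters R Gamma) _ (charV_subproof chi).

Lemma char_valV chi t : char_val (charV chi) t = (char_val chi t)^-1.
Proof. by rewrite /char_val /charV set_valE. Qed.

Lemma char_valM chi psi t :
  char_val (charM chi psi) t = char_val chi t * char_val psi t.
Proof. by rewrite /char_val /charM set_valE. Qed.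

Lemma char_ext chi psi : (forall t, char_val chi t = char_val psi t) -> chi = psi.
Proof. by move=> H; apply: val_inj; apply/funext. Qed.

End Characters.

(** Near-covering form of compactness for the filter of eventually large finite
    subsets of I. *)
Lemma compact_finite_cover (X : topologicalType) (I : eqType) (K : set X)
    (U : I -> set X) : compact K -> (forall x, K x -> exists i, nbhs x (U i)) ->
  exists Q : seq I, forall x, K x -> exists2 i, i \in Q & U i x.
Proof.
move=> /compact_near_coveringP KC KU.
pose F : set_system (seq I) :=
  [set E : set (seq I) |
    exists Q : seq I, forall Q' : seq I, {subset Q <= Q'} -> E Q'].
have FF : Filter F.
  split.
  - by exists [::].
  - move=> E1 E2 [Q1 H1] [Q2 H2]; exists (Q1 ++ Q2) => Q QQ; split.
      by apply: H1 => i iQ; apply: QQ; rewrite mem_cat iQ.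
    by apply: H2 => i iQ; apply: QQ; rewrite mem_cat iQ orbT.
  - by move=> E1 E2 E12 [Q H]; exists Q => Q' /H/E12.
have [x Kx|Q H] := KC _ F (fun Q x => exists2 i, i \in Q & U i x) FF.
  have [i iU] := KU x Kx.
  exists (U i, [set Q : seq I | i \in Q]) => /=.
    by split=> //; exists [:: i] => Q; apply; rewrite mem_head.
  by move=> [y Q] /= [Uy iQ]; exists i.
by exists Q => x /(H Q (fun _ => id)).
Qed.

Section Cocycle.
Context (R : realType) (G : topologicalType) (S : groupoid G).
Context (Gamma : zmodType) (c : G -> Gamma) (hc : cocycle S c).
Local Notation C := (R[i]^o).
Implicit Types (f g : G -> C) (P : set G) (chi psi : dual_group R Gamma).

Lemma cocycle_near x : \forall y \near x, c y = c x.
Proof.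
have [cc _] := hc; apply: (cc x [set t | t = c x]).
exact: (@discrete_set1 (discrete_topology Gamma)).
Qed.

Lemma cocycle_comp (q : Gamma -> C) : continuous (q \o c).
Proof.
move=> x; apply/cvg_rnormP => e e0; have := cocycle_near x; apply: filterS => y /= ->.
by rewrite subrr rnorm0.
Qed.

Lemma cocycle_fiber_open t : open [set x | c x = t].
Proof.
by rewrite openE => x /= <-; exact: cocycle_near.
Qed.

Lemma cocycle_fiber_closed t : closed [set x | c x = t].
Proof.
rewrite -[X in closed X]setCK; apply: open_closedC; rewrite openE => x /= cx.
by have := cocycle_near x; apply: filterS => y yx /=; rewrite yx.
Qed.

Definition fiber_part (t : Gamma) f x : C := if c x == t then f x else 0.

Lemma Cc_fiber_part P t f : Cc P f -> Cc (P `&` [set x | c x = t]) (fiber_part t f).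
Proof.
move=> cf; have [ff _ _] := cf.
have cutE : fiber_part t f = (fun x => (if c x == t then 1 else 0) * f x).
  by apply/funext => x; rewrite /fiber_part; case: ifP; rewrite ?mul1r ?mul0r.
have [cc kc sc] : Cc P (fiber_part t f).
  apply: (Cc_supp cf); last by move=> x fx; rewrite /fiber_part fx; case: ifP.
  rewrite cutE => x; apply: cvgM; last exact: ff.
  exact: (@cocycle_comp (fun s => if s == t then 1 else 0)).
split=> // x xs; split; first exact: sc.
have : closure [set x | c x = t] x.
  move: x xs; apply: closureS => x /=; rewrite /fiber_part.
  by case: ifP => [/eqP//|_]; rewrite eqxx.
by rewrite -(closure_id _).1 //; exact: cocycle_fiber_closed.
Qed.

(** The fibres of the cocycle form an open partition, so that a compact set meets
    only finitely many of them. *)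
Lemma Cc_fibers P f : Cc P f -> exists2 Q : seq Gamma, uniq Q &
  forall x, f x != 0 -> c x \in Q.
Proof.
move=> [_ kf _].
have [|Q fQ] := compact_finite_cover (U := fun t => [set x | c x = t]) kf.
  by move=> x _; exists (c x); exact: cocycle_near.
exists (undup Q); first exact: undup_uniq.
move=> x fx; have [|t tQ /= ->] := fQ x; first exact: subset_closure.
by rewrite mem_undup.
Qed.

Lemma sum_fiber_part f (Q : seq Gamma) : uniq Q -> (forall x, f x != 0 -> c x \in Q) ->
  f = \sum_(t <- Q) fiber_part t f.
Proof.
move=> uQ fQ; apply/funext => x; rewrite fct_sumE.
have [fx|fx] := eqVneq (f x) 0.
  by rewrite big1 // => t _; rewrite /fiber_part fx; case: ifP.
rewrite (bigD1_seq (c x)) //=; last exact: fQ.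
rewrite big1 ?addr0 /fiber_part ?eqxx // => t; rewrite eq_sym.
by case: eqP.
Qed.

Context (A : reduced_algebra R S).
Local Notation j := (fourier_coef (A := A)).
Implicit Types (a b : A).

Lemma dual_action_exists chi a :
  exists2 b, rnorm b <= rnorm a & forall x, j b x = char_val chi (c x) * j a x.
Proof.
have [_ cM] := hc.
apply: phase_mul => [|x|x y xy]; first exact: cocycle_comp.
  exact: char_val_norm.
by rewrite (cocycle_div cM) // char_valD char_valN.
Qed.

Lemma dual_actionE chi a x : j (dual_action c chi a) x = char_val chi (c x) * j a x.
Proof.
have [b _ bP] := dual_action_exists chi a.
have : exists b, [set b | forall x, j b x = char_val chi (c x) * j a x] b by exists b.
by move=> /(xgetPex 0); apply.
Qed.

Lemma dual_action_norm chi a : rnorm (dual_action c chi a) = rnorm a.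
Proof.
have le psi b : rnorm (dual_action c psi b) <= rnorm b.
  have [d db dP] := dual_action_exists psi b.
  suff -> : dual_action c psi b = d by [].
  by apply: fourier_inj => x; rewrite dual_actionE dP.
apply/eqP; rewrite eq_le le /=.
have {1}-> : a = dual_action c (charV chi) (dual_action c chi a); last exact: le.
apply: fourier_inj => x; rewrite !dual_actionE char_valV mulrA mulVf ?mul1r //.
exact: char_val_neq0.
Qed.

End Cocycle.

(** * Simple integrals *)

Section SimpleIntegral.
Context (R : realType) (d : measure_display) (T : measurableType d).
Context (mu : probability T R).

(** The simple maps of Bochner integration with an arbitrary target, so that
    pairs and lists of them are again of this kind. *)
Definition finite_valued (I : Type) (h : T -> I) : Prop :=
  finite_set (range h) /\ forall i, measurable (h @^-1` [set i]).

Local Notation pr E := (fine (mu E)).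

Lemma finite_valued_pair (I J : Type) (h : T -> I) (k : T -> J) :
  finite_valued h -> finite_valued k -> finite_valued (fun t => (h t, k t)).
Proof.
move=> [fh mh] [fk mk]; split.
  by apply: sub_finite_set (finite_setX fh fk) => _ [t _ <-]; split; exists t.
move=> [i j].
have -> : (fun t => (h t, k t)) @^-1` [set (i, j)] =
    h @^-1` [set i] `&` k @^-1` [set j].
  by apply/seteqP; split=> t /=; [case=> -> ->|case=> -> ->].
exact: measurableI.
Qed.

Lemma finite_valued_preimage (I : Type) (h : T -> I) (Y : set I) :
  finite_valued h -> measurable (h @^-1` Y).
Proof.
move=> [fh mh].
have -> : h @^-1` Y = \bigcup_(i in range h `&` Y) (h @^-1` [set i]).
  by apply/seteqP; split=> [t Yt|t [i [_ Yi] /= ->] //]; exists (h t); split => //; exists t.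
by apply: fin_bigcup_measurable => [|i _//]; exact: finite_setIl.
Qed.

Lemma finite_valued_comp (I J : Type) (h : T -> I) (k : I -> J) :
  finite_valued h -> finite_valued (k \o h).
Proof.
move=> fh; split; last by move=> j; exact: (finite_valued_preimage (k @^-1` [set j]) fh).
have -> : range (k \o h) = k @` range h by rewrite image_comp.
by apply: finite_image; case: fh.
Qed.

Lemma measurable_finite_valued (I : Type) (h : T -> I) (g : I -> R) :
  finite_valued h -> measurable_fun setT (g \o h).
Proof. by move=> fh _ Y mY; rewrite setTI; exact: (finite_valued_preimage (g @^-1` Y) fh). Qed.

Lemma integral_finite_valued (I : choiceType) (h : T -> I) (g : I -> R) (P : set I) :
  finite_valued h -> finite_set P -> range h `<=` P -> (forall i, 0 <= g i) ->
  (\int[mu]_t (g (h t))%:E = (\sum_(i \in P) g i * pr (h @^-1` [set i]))%:E)%E.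
Proof.
move=> [fh mh] fP hP g0.
transitivity (\int[mu]_t (\sum_(i \in P) ((g i)%:E * (\1_(h @^-1` [set i]) t)%:E)))%E.
  apply: eq_integral => t _; rewrite (fsbigD1 (h t)) //=; last by apply: hP; exists t.
  rewrite indicE mem_set // mule1 fsbig1 ?adde0 // => i [_ /= it].
  by rewrite indicE memNset ?mule0 //= => /esym.
rewrite ge0_integral_fsum //=.
- rewrite -fsumEFin //; apply: eq_fsbigr => i _.
  rewrite ge0_integralZl_EFin //=.
  + by rewrite integral_indic // setIT EFinM fineK // fin_num_measure.
  + by apply/measurable_EFinP; exact: measurable_indic.
- move=> i; apply/measurable_EFinP; exact: measurable_funM.
- by move=> i t _; rewrite mule_ge0 // lee_fin.
Qed.

(** The level sets of h refine those of f o h, and those over points of P outside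
    the range of h are empty. *)
Lemma simple_integral_comp (V : normedModType R[i]) (I : choiceType)
    (h : T -> I) (f : I -> V) (P : set I) :
  finite_valued h -> finite_set P -> range h `<=` P ->
  simple_integral mu (f \o h) = \sum_(i \in P) (pr (h @^-1` [set i]))%:C%C *: f i.
Proof.
move=> fh fP hP.
have [ff mf] := finite_valued_comp f fh.
transitivity (\sum_(v \in range (f \o h)) \sum_(i \in P)
    (if f i == v then (pr (h @^-1` [set i]))%:C%C *: f i else 0)).
  apply: eq_fsbigr => v _.
  have -> : pr ((f \o h) @^-1` [set v]) =
      \sum_(i \in P) (if f i == v then 1 else 0) * pr (h @^-1` [set i]).
    apply: EFin_inj.
    rewrite -(integral_finite_valued fh fP hP
      (g := fun i => if f i == v then 1 else 0)); last first.
      by move=> i; case: ifP.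
    rewrite fineK ?fin_num_measure // -[X in mu X]setIT -integral_indic //.
    apply: eq_integral => t _; rewrite indicE /=.
    by case: eqP => [e|e]; [rewrite mem_set|rewrite memNset].
  rewrite !fsbig_finite //= rmorph_sum scaler_suml; apply: eq_bigr => i _.
  by case: eqP => [->|_]; rewrite ?mul1r ?mul0r ?rmorph0 ?scale0r.
rewrite exchange_fsbig //; apply: eq_fsbigr => i iP.
have [[t _ ti]|hi] := pselect (range h i).
  rewrite (fsbigD1 (f i)) //=; last by exists t => //=; rewrite ti.
  by rewrite eqxx fsbig1 ?addr0 // => v [_ /= vi]; case: eqP => // /esym.
have -> : h @^-1` [set i] = set0.
  by apply/seteqP; split=> // t /= ti; apply: hi; exists t.
by rewrite measure0 /= fsbig1 ?scale0r // => v _; case: ifP.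
Qed.

End SimpleIntegral.

(** * The Bochner integral *)

Section Bochner.
Context (R : realType) (d : measure_display) (T : measurableType d).
Context (mu : probability T R).

Lemma integral_cstP (r : R) : (\int[mu]_t r%:E = r%:E)%E.
Proof.
rewrite integral_cst //; set m := (X in (_ * X)%E).
by have -> : m = 1%E; [exact: probability_setT|rewrite mule1].
Qed.

(** Both integrals are sums over the common refinement of the level sets of s and
    s'. *)
Lemma simple_integral_dist (V : normedModType R[i]) (s s' : T -> V) :
  simple_map s -> simple_map s' ->
  ((rnorm (simple_integral mu s - simple_integral mu s'))%:E <=
   \int[mu]_t (rnorm (s t - s' t))%:E)%E.
Proof.
move=> ss ss'; pose h t := (s t, s' t).
have fh : finite_valued h by exact: finite_valued_pair.
have fP : finite_set (range h) by case: fh.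
have Es := simple_integral_comp mu (fst : V * V -> V) fh fP (@subset_refl _ _).
have Es' := simple_integral_comp mu (snd : V * V -> V) fh fP (@subset_refl _ _).
have -> : simple_integral mu s = _ := Es; have -> : simple_integral mu s' = _ := Es'.
rewrite (integral_finite_valued mu (g := fun p => rnorm (p.1 - p.2)) fh fP
  (@subset_refl _ _)); last first.
  by move=> p; exact: rnorm_ge0.
rewrite lee_fin !fsbig_finite //= -sumrB.
elim/big_ind2: _ => [|x1 x2 y1 y2 H1 H2|p _]; first by rewrite rnorm0.
  by apply: le_trans (ler_rnormD _ _) _; exact: lerD.
rewrite -scalerBr rnormZ rnorm_real ger0_norm ?fine_ge0 //.
by rewrite mulrC.
Qed.

(** Two approximating sequences are close to each other in L^1, and so are their
    integrals by the previous bound. *)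
Lemma bochner_unique (V : normedModType R[i]) (F : T -> V) (x x' : V) :
  is_bochner_integral mu F x -> is_bochner_integral mu F x' -> x = x'.
Proof.
move=> [s [ss ms s0 sx]] [s' [ss' ms' s0' sx']].
apply/eqP; rewrite -subr_eq0; apply/eqP; apply: rnorm_le0 => e e0.
have e4 : 0 < e / 4 by rewrite divr_gt0.
have near0 (u : nat -> \bar R) : u n @[n --> \oo] --> 0%E ->
    \forall n \near \oo, (u n < (e / 4)%:E)%E.
  move=> /fine_cvgP[fu /cvgrPdist_lt /(_ _ e4) u0].
  near=> n; have fn : u n \is a fin_num by near: n.
  rewrite -(fineK fn) lte_fin (le_lt_trans (ler_norm _)) //.
  by rewrite -normrN -[- _]sub0r; near: n.
move/cvg_rnormP: (sx) => /(_ _ e4) nx; move/cvg_rnormP: (sx') => /(_ _ e4) nx'.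
have [n [[n1 n2] [n3 n4]]] := filter_ex (filterI (filterI nx nx')
  (filterI (near0 _ s0) (near0 _ s0'))).
have : ((rnorm (simple_integral mu (s n) - simple_integral mu (s' n)))%:E <=
        (e / 4)%:E + (e / 4)%:E)%E.
  apply: le_trans (simple_integral_dist (ss n) (ss' n)) _.
  apply: le_trans (leeD (ltW n3) (ltW n4)).
  rewrite -ge0_integralD //=; last first.
  - by apply/measurable_EFinP.
  - by move=> t _; rewrite lee_fin rnorm_ge0.
  - by apply/measurable_EFinP.
  - by move=> t _; rewrite lee_fin rnorm_ge0.
  apply: ge0_le_integral => //=.
  - by move=> t _; rewrite lee_fin rnorm_ge0.
  - apply/measurable_EFinP.
    exact: (measurable_finite_valued (fun p => rnorm (p.1 - p.2))
      (finite_valued_pair (ss n) (ss' n))).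
  - by apply: emeasurable_funD; apply/measurable_EFinP.
  - move=> t _; rewrite -EFinD lee_fin (rnormBC (F t) (s n t)).
    exact: ler_rnormB.
rewrite -EFinD lee_fin.
have := ler_rnormB x (simple_integral mu (s n)) x'.
have := ler_rnormB (simple_integral mu (s n)) (simple_integral mu (s' n)) x'.
by rewrite (rnormBC (simple_integral mu (s' n)) x'); move: n1 n2; clear; rnorm_lra.
Unshelve. all: by end_near. Qed.

Lemma bochner_integralE (V : normedModType R[i]) (F : T -> V) (x : V) :
  is_bochner_integral mu F x -> bochner_integral mu F = x.
Proof.
move=> Fx; have : exists y, is_bochner_integral mu F y by exists x.
by move=> /(xgetPex 0) /bochner_unique; apply.
Qed.

Lemma bochner_isometry (V : normedModType R[i]) (U : V -> V) (F : T -> V) (x : V) :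
  (forall k a b, U (k *: a + b) = k *: U a + U b) ->
  (forall a, rnorm (U a) = rnorm a) ->
  is_bochner_integral mu F x -> is_bochner_integral mu (U \o F) (U x).
Proof.
move=> Ulin Unorm [s [ss ms s0 sx]].
have U0 : U 0 = 0 by apply: rnorm_eq0; rewrite Unorm rnorm0.
have UD a b : U (a + b) = U a + U b by rewrite -[a]scale1r Ulin !scale1r.
have UZ k a : U (k *: a) = k *: U a by rewrite -[k *: a]addr0 Ulin U0 addr0.
have UB a b : U (a - b) = U a - U b by rewrite addrC -scaleN1r Ulin scaleN1r addrC.
have UN n t : rnorm ((U \o F) t - (U \o s n) t) = rnorm (F t - s n t).
  by rewrite /= -UB Unorm.
exists (fun n => U \o s n); split.
- by move=> n; exact: (finite_valued_comp U (ss n)).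
- by move=> n; under eq_fun do rewrite UN; exact: ms.
- rewrite [X in X @ _](_ : _ = fun n => (\int[mu]_t (rnorm (F t - s n t))%:E)%E) //.
  by apply/funext => n; apply: eq_integral => t _; rewrite UN.
have sU n : simple_integral mu (U \o s n) = U (simple_integral mu (s n)).
  have fP : finite_set (range (s n)) by case: (ss n).
  rewrite (simple_integral_comp mu _ (ss n) fP (@subset_refl _ _)).
  rewrite /simple_integral !fsbig_finite //=.
  elim/big_rec2: _ => [|v a b _ ->]; first by rewrite U0.
  by rewrite UD UZ.
under eq_fun do rewrite sU.
apply/cvg_rnormP => e e0; move/cvg_rnormP: sx => /(_ _ e0).
by apply: filterS => n; rewrite -UB Unorm.
Qed.

(** A measure-preserving surjection leaves both the values of a simple map and the
    measures of its level sets unchanged. *)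
Lemma bochner_translate (V : normedModType R[i]) (tau : T -> T) (F : T -> V) (x : V) :
  measurable_fun setT tau -> set_surj setT setT tau ->
  (forall E, measurable E -> mu (tau @^-1` E) = mu E) ->
  is_bochner_integral mu F x -> is_bochner_integral mu (F \o tau) x.
Proof.
move=> mtau stau inv [s [ss ms s0 sx]].
have rs n : range (s n \o tau) = range (s n).
  apply/seteqP; split=> [_ [t _ <-]|_ [t _ <-]]; first by exists (tau t).
  by have [u _ <-] := stau t I; exists u.
exists (fun n => s n \o tau); split.
- move=> n; split; first by rewrite rs; case: (ss n).
  move=> v; have := mtau measurableT _ ((ss n).2 v); by rewrite setTI.
- move=> n.
  exact: (measurableT_comp (ms n) mtau).
- rewrite [X in X @ _](_ : _ = fun n => (\int[mu]_t (rnorm (F t - s n t))%:E)%E) //.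
  apply/funext => n.
  rewrite [LHS](_ : _ = \int[mu]_(t in tau @^-1` setT)
    ((fun t => (rnorm (F t - s n t))%:E) \o tau) t)%E; last by rewrite preimage_setT.
  rewrite -(ge0_integral_pushforward mtau mu) //.
  + by apply: eq_measure_integral => E mE _; exact: inv.
  + exact/measurable_EFinP.
  + by move=> t _; rewrite lee_fin rnorm_ge0.
have sU n : simple_integral mu (s n \o tau) = simple_integral mu (s n).
  rewrite /simple_integral rs; apply: eq_fsbigr => v _.
  congr ((fine _)%:C%C *: _); exact: (inv _ ((ss n).2 v)).
by under eq_fun do rewrite sU.
Qed.

(** The integrals of the approximating simple maps are Cauchy because integration
    of simple maps is a contraction for the uniform norm.  These maps take their
    values among those of F, so that linear properties of the values of F pass
    to their integrals. *)
Lemma bochner_exists (V : completeNormedModType R[i]) (F : T -> V) :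
  (forall n, exists s, [/\ simple_map s, range s `<=` range F &
     forall t, rnorm (F t - s t) <= inv_succ R n]) ->
  exists s : nat -> T -> V, exists x, [/\ forall n, simple_map (s n),
    forall n, range (s n) `<=` range F,
    simple_integral mu (s n) @[n --> \oo] --> x & is_bochner_integral mu F x].
Proof.
move=> /choice[s sP].
have ss n : simple_map (s n) by case: (sP n).
have Fs n t : rnorm (F t - s n t) <= inv_succ R n by case: (sP n) => _ _; apply.
have ms n m : measurable_fun setT (fun t => rnorm (s m t - s n t)).
  exact: (measurable_finite_valued (fun p => rnorm (p.1 - p.2))
      (finite_valued_pair (ss m) (ss n))).
have [|x sx] := @rcauchy_cvg R V (fun n => simple_integral mu (s n)).
  move=> n m; rewrite -lee_fin.
  apply: le_trans (simple_integral_dist (ss n) (ss m)) _.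
  apply: (@le_trans _ _ (\int[mu]_t (inv_succ R n + inv_succ R m)%:E)%E); last first.
    by rewrite integral_cstP.
  apply: ge0_le_integral => //=.
  - by move=> t _; rewrite lee_fin rnorm_ge0.
  - exact/measurable_EFinP/ms.
  - move=> t _; rewrite lee_fin.
    have := ler_rnormB (s n t) (F t) (s m t); have := Fs n t; have := Fs m t.
    by rewrite (rnormBC _ (F t)); clear; rnorm_lra.
exists s, x; split=> //; first by move=> n; case: (sP n).
have mF n : measurable_fun setT (fun t => rnorm (F t - s n t)).
  apply: (@measurable_fun_cvg _ _ _ _ (fun m t => rnorm (s m t - s n t))) => // t _.
  apply: cvg_rnorm; apply: cvgB; last exact: cvg_cst.
  apply/cvg_rnormP => e e0; have := near_inv_nat e0; apply: filterS => m.
  exact: le_lt_trans.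
exists s; split=> //.
apply: (@squeeze_cvge _ _ _ _ (fun=> 0%E) _ (fun n => (inv_succ R n)%:E)).
- apply: nearW => n; apply/andP; split.
    by apply: integral_ge0 => t _; rewrite lee_fin rnorm_ge0.
  rewrite -[leRHS]integral_cstP.
  apply: ge0_le_integral => //=.
  - by move=> t _; rewrite lee_fin rnorm_ge0.
  - exact/measurable_EFinP.
  - by move=> t _; rewrite lee_fin.
- exact: cvg_cst.
- apply: cvg_EFin; first exact: nearW.
  apply/cvgrPdist_lt => e e0; have := near_inv_nat e0; apply: filterS => n.
  by rewrite sub0r normrN gtr0_norm ?inv_succ_gt0.
Qed.

End Bochner.

(** * Characters separate points *)

Section Separation.
Context (R : realType) (Gamma : zmodType).
Local Notation C := (R[i]^o).

(** The graph of a character of a subgroup, so that the union of a chain of such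
    characters is again one. *)
Record partial_char (D : set (Gamma * R[i])) : Prop := PartialChar {
  pchar0 : D (0, 1);
  pcharB : forall s t u v, D (s, u) -> D (t, v) -> D (s - t, u / v);
  pchar_norm : forall s u, D (s, u) -> `|u| = 1;
  pchar_fun : forall u, D (0, u) -> u = 1
}.

Lemma pchar_neq0 D s u : partial_char D -> D (s, u) -> u != 0.
Proof. by move=> pD /(pchar_norm pD) u1; rewrite -normr_eq0 u1 oner_eq0. Qed.

Lemma pchar_mulz D s u (n : int) : partial_char D -> D (s, u) -> D (s *~ n, u ^ n).
Proof.
move=> pD su.
have DN t v : D (t, v) -> D (- t, v^-1).
  by move=> tv; have := pcharB pD (pchar0 pD) tv; rewrite sub0r mul1r.
have Dn (m : nat) : D (s *+ m, u ^+ m).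
  elim: m => [|m IH]; first exact: pchar0.
  by have := pcharB pD IH (DN _ _ su); rewrite opprK invrK -mulrSr -exprSr.
case: n => n; first exact: Dn.
by rewrite NegzE mulrNz -exprnN; apply: DN; exact: Dn.
Qed.

(** For w = 1 the root is taken among those of 1 + X + ... + X^(m-1), which does not
    vanish at 1. *)
Lemma nontrivial_root (w : R[i]) (m : nat) : (1 < m)%N -> `|w| = 1 ->
  exists z : R[i], [/\ z != 1, `|z| = 1 & z ^+ m = w].
Proof.
move=> m1 w1; have m0 : (0 < m)%N by exact: ltnW.
have norm1 (z : R[i]) : z ^+ m = w -> `|z| = 1.
  move=> zw; have := pexprn_eq1 m (normr_ge0 z).
  by rewrite -normrX zw w1 eqxx gtn_eqF //= => /esym/eqP.
have [wE|wN] := eqVneq w 1; last first.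
  exists (m.-root w); have zw := rootCK m0 w; split=> //; last exact: norm1.
  by apply: contra_neq wN => z1; rewrite -zw z1 expr1n.
pose p : {poly R[i]} := \poly_(i < m) 1.
have sp : size p = m by rewrite size_poly_eq // oner_eq0.
have /closed_rootP[z] : size p != 1%N by rewrite sp neq_ltn m1 orbT.
rewrite /root horner_poly => /eqP pz.
have {}pz : \sum_(i < m) z ^+ i = 0.
  by rewrite -[RHS]pz; apply: eq_bigr => i _; rewrite mul1r.
have zm : z ^+ m = w.
  by apply/eqP; rewrite wE -subr_eq0 subrX1 pz mulr0.
exists z; split=> //; last exact: norm1.
apply: contraPneq pz => ->; under eq_bigr do rewrite expr1n.
by rewrite sumr_const card_ord => /eqP; rewrite pnatr_eq0 gtn_eqF.
Qed.

(** If no nonzero multiple of g lies in the domain, the value at g is free, and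
    -1 will do.  Otherwise let m g be the least positive multiple in the domain;
    then m > 1, and the value at g is an m-th root of the value at m g. *)
Lemma pchar_value D g : partial_char D -> (forall u, ~ D (g, u)) ->
  exists z : R[i], [/\ z != 1, `|z| = 1 &
    forall (n : int) u, D (g *~ n, u) -> u = z ^ n].
Proof.
move=> pD gD.
have [[m0 [m0_gt0 Dm0]]|noD] :=
  pselect (exists m : nat, (0 < m)%N /\ exists u, D (g *+ m, u)); last first.
  exists (-1); split; first by rewrite lt_eqF // ltrN10_ ltr01.
    by rewrite normrN1.
  move=> [[|n]|n] u Du; first by rewrite mulr0z in Du; rewrite (pchar_fun pD Du).
    by exfalso; apply: noD; exists n.+1; split=> //; exists u.
  exfalso; apply: noD; exists n.+1; split=> //; exists (u ^-1).
  have := pchar_mulz (-1) pD Du.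
  by rewrite NegzE -mulrzA mulrN1 opprK.
have ex : exists m, (0 < m)%N && `[< exists u, D (g *+ m, u) >].
  by exists m0; rewrite m0_gt0; apply/asboolP.
case: (ex_minnP ex) => m /andP[m_gt0 /asboolP[w Dw]] m_min.
have m1 : (1 < m)%N.
  rewrite ltn_neqAle m_gt0 andbT; apply/eqP => mE.
  by apply: (gD w); rewrite -mE in Dw.
have [z [z1 zn zm]] := nontrivial_root m1 (pchar_norm pD Dw).
exists z; split=> // n u Du.
have qD := pchar_mulz (n %/ m)%Z pD Dw.
have := pcharB pD Du qD.
have r0 : (0 <= n %% m)%Z by rewrite modz_ge0 // gt_eqF.
have -> : g *~ n - g *+ m *~ (n %/ m)%Z = g *~ (n %% m)%Z.
  by rewrite pmulrn -mulrzA -mulrzBr {1}(divz_eq n m) mulrC addrAC subrr add0r.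
have rm : (`|(n %% m)%Z| < m)%N by rewrite -ltz_nat gez0_abs // ltz_pmod.
rewrite -(gez0_abs r0) => Dr.
have r_eq0 : `|(n %% m)%Z|%N = 0%N.
  apply/eqP; rewrite -leqn0 leqNgt; apply/negP => rpos.
  suff /m_min : (0 < `|(n %% m)%Z|)%N && `[< exists u, D (g *+ `|(n %% m)%Z|%N, u) >].
    by rewrite leqNgt rm.
  by rewrite rpos; apply/asboolP; exists (u / w ^ (n %/ m)%Z).
rewrite r_eq0 mulr0z in Dr.
have w0 := pchar_neq0 pD Dw.
have := pchar_fun pD Dr => /(canRL (mulfVK (expfz_neq0 _ w0))); rewrite mul1r => ->.
rewrite {2}(divz_eq n m) -(gez0_abs r0) r_eq0 addr0 mulrC -zm.
by rewrite exprnP exprz_exp.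
Qed.

(** The extension sends s + n g to u z^n whenever D contains (s, u); the choice of
    z makes this well defined. *)
Lemma pchar_extend D g : partial_char D -> (forall u, ~ D (g, u)) ->
  exists (z : R[i]) D', [/\ z != 1, partial_char D', D `<=` D' & D' (g, z)].
Proof.
move=> pD gD; have [z [z1 zn zP]] := pchar_value pD gD.
have z0 : z != 0 by rewrite -normr_eq0 zn oner_eq0.
exists z, [set p | exists n : int, D (p.1 - g *~ n, p.2 / z ^ n)].
split=> //; last by exists 1; rewrite /= subrr expr1z divff //; exact: pchar0.
  split.
  - by exists 0; rewrite /= mulr0z subr0 expr0z divr1; exact: pchar0.
  - move=> s t u v [n Dn] [k Dk]; exists (n - k) => /=.
    have := pcharB pD Dn Dk => /=.
    have -> : s - g *~ n - (t - g *~ k) = s - t - g *~ (n - k).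
      by rewrite mulrzBr !opprB addrACA [RHS]addrACA; congr (_ + _); exact: addrC.
    suff -> : u / z ^ n / (v / z ^ k) = u / v / z ^ (n - k) by [].
    by rewrite expfzDr // -invr_expz !invfM !invrK; ring.
  - move=> s u [n /(pchar_norm pD)] /=; rewrite normrM normfV.
    have -> : `|z ^ n| = 1.
      case: n => n; first by rewrite -exprnP normrX zn expr1n.
      by rewrite NegzE -exprnN normfV normrX zn expr1n invr1.
    by rewrite invr1 mulr1.
  - move=> u [n /=]; rewrite sub0r -mulrNz => /zP.
    rewrite -invr_expz => /(canRL (mulfVK (expfz_neq0 _ z0))).
    by rewrite mulVf ?expfz_neq0.
by move=> [s u] Du; exists 0; rewrite /= mulr0z subr0 expr0z divr1.
Qed.

(** Zorn's lemma, starting from a character of the subgroup generated by g that is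
    nontrivial at g. *)
Lemma char_separates (g : Gamma) : g != 0 ->
  exists chi : dual_group R Gamma, char_val chi g != 1.
Proof.
move=> g0.
have p1 : partial_char [set (0, 1)].
  split=> //=.
  - by move=> s t u v [-> ->] [-> ->]; rewrite subrr divr1.
  - by move=> s u [_ ->]; rewrite normr1.
  - by move=> u [].
have [|z [D0 [z1 pD0 _ D0g]]] := pchar_extend (g := g) p1.
  by move=> u [/eqP]; rewrite (negbTE g0).
(* The empty set is admitted as the union of the empty chain. *)
pose P (D : set (Gamma * R[i])) := D = set0 \/ (partial_char D /\ D0 `<=` D).
have [F FP Ftot|D [PD Dmax]] := @Zorn_bigcup _ P.
  have [[D [FD D_ne]]|F0] := pselect (exists D, F D /\ D !=set0); last first.
    left; apply/seteqP; split=> // x [D FD Dx]; apply: F0; exists D; split=> //.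
    by exists x.
  have FP' E x : F E -> E x -> partial_char E /\ D0 `<=` E.
    by move=> FE Ex; case: (FP _ FE) => // E0; rewrite E0 in Ex.
  have [x Dx] := D_ne; have [pD D0D] := FP' _ _ FD Dx.
  right; split; last by move=> y /D0D Dy; exists D.
  split.
  - by exists D => //; exact: pchar0.
  - move=> s t u v [E1 FE1 E1s] [E2 FE2 E2t].
    have [p1' _] := FP' _ _ FE1 E1s; have [p2' _] := FP' _ _ FE2 E2t.
    have [E12|E21] := Ftot _ _ FE1 FE2.
      by exists E2 => //; apply: pcharB => //; exact: E12.
    by exists E1 => //; apply: pcharB => //; exact: E21.
  - by move=> s u [E FE Es]; have [pE _] := FP' _ _ FE Es; exact: (pchar_norm pE Es).
  - by move=> u [E FE Es]; have [pE _] := FP' _ _ FE Es; exact: (pchar_fun pE Es).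
have [pD D0D] : partial_char D /\ D0 `<=` D.
  case: PD => // D_0; exfalso; apply: (Dmax D0); last by right; split.
  by rewrite D_0; split=> // /(_ _ D0g) [].
have Dtot h : exists u, D (h, u).
  apply: contrapT => noh.
  have [|u [D' [_ pD' DD' D'h]]] := pchar_extend (g := h) pD.
    by move=> u Du; apply: noh; exists u.
  apply: (Dmax D'); last by right; split=> //; exact: (subset_trans D0D DD').
  by split=> // /(_ _ D'h) Dh; apply: noh; exists u.
have [chi chiP] := choice Dtot.
have chi_uniq h u : D (h, u) -> chi h = u.
  move=> Dh; have := pcharB pD (chiP h) Dh; rewrite subrr => /(pchar_fun pD).
  by move=> /(canRL (mulfVK (pchar_neq0 pD Dh))); rewrite mul1r.
have chi_in : (chi : Gamma -> C) \in @characters R Gamma.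
  rewrite inE; split=> [s t|t]; last exact: (pchar_norm pD (chiP t)).
  apply: chi_uniq.
  have D_t := pcharB pD (pchar0 pD) (chiP t).
  by have := pcharB pD (chiP s) D_t; rewrite sub0r mul1r opprK invrK.
exists (exist (fun f => f \in @characters R Gamma) _ chi_in).
rewrite /char_val set_valE /=.
by rewrite (chi_uniq _ _ (D0D _ D0g)).
Qed.

End Separation.

(** * The dual group as a measure space *)

Section DualGroupMeasure.
Context (R : realType) (Gamma : zmodType).
Local Notation C := (R[i]^o).
Local Notation dual := (dual_group R Gamma).
Local Notation bdual := (borel_dual R Gamma).

Lemma char_val_continuous t : continuous (fun chi : dual => char_val chi t : C).
Proof.
move=> chi.
have : (fun psi : dual => char_val psi : {ptws Gamma -> C}) @ chi -->
    (char_val chi : {ptws Gamma -> C}).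
  exact: (@initial_continuous _ _ (set_val : @characters R Gamma -> {ptws Gamma -> C})).
move=> H0; have H := (@pointwise_cvgP (discrete_topology Gamma) C _ _ (fmap_filter _ _)).1 H0 t.
exact: H.
Qed.

Lemma charM_continuous (psi : dual) : continuous (charM psi : dual -> dual).
Proof.
have H : continuous (fun chi : dual => char_val (charM psi chi) : {ptws Gamma -> C}).
  move=> chi.
  have Ht (t : Gamma) : (fun phi : dual => char_val (charM psi phi) t : C) @ chi -->
      (char_val (charM psi chi) t : C).
    have -> : (fun phi : dual => char_val (charM psi phi) t : C) =
        (fun phi => char_val psi t * char_val phi t).
      by apply/funext => phi; rewrite char_valM.
    rewrite char_valM.
    exact: (@continuous_comp dual C C (fun phi => char_val phi t)
      (fun z => char_val psi t * z) chi (@char_val_continuous t chi)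
      (@mulrl_continuous _ _ _)).
  exact: ((@pointwise_cvgP (discrete_topology Gamma) C _ _
    (@fmap_filter _ _ _ _ (nbhs_filter chi))).2 Ht).
exact: (@continuous_comp_initial _ _ _
  (set_val : @characters R Gamma -> {ptws Gamma -> C}) (charM psi : dual -> dual) H).
Qed.

Lemma open_measurable_dual (E : set bdual) : @open dual E -> measurable E.
Proof. by move=> oE; apply: sub_sigma_algebra. Qed.

Lemma charM_measurable (psi : dual) :
  measurable_fun setT (charM psi : bdual -> bdual).
Proof.
apply: (@measurability _ _ bdual bdual setT (charM psi) (@open dual)) => //.
move=> _ [E oE <-]; rewrite setTI; apply: open_measurable_dual.
by move/continuousP: (@charM_continuous psi); apply.
Qed.

(** Translation by psi is invertible, so that invariance under direct images turns
    into invariance under preimages. *)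
Lemma haar_translate (mu : probability bdual R) (psi : dual) (E : set bdual) :
  haar mu -> measurable E -> mu (charM psi @^-1` E) = mu E.
Proof.
move=> hmu mE.
have mE' : measurable ((charM psi : bdual -> bdual) @^-1` E).
  by have := charM_measurable psi measurableT mE; rewrite setTI.
rewrite -[LHS](hmu psi) //; congr (mu _).
apply/seteqP; split=> [_ [chi Echi <-] //|chi Echi].
have psiK : charM psi (charM (charV psi) chi) = chi.
  apply: char_ext => t; rewrite !char_valM char_valV mulrA mulfV ?mul1r //.
  exact: char_val_neq0.
by exists (charM (charV psi) chi) => //=; rewrite psiK.
Qed.

(** The range of g is sliced into intervals of length e. *)
Lemma finite_partition_real (g : bdual -> R) (e : R) : 0 < e ->
  (forall chi, 0 <= g chi <= 2) -> (forall r, measurable [set chi | g chi < r]) ->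
  exists2 h : bdual -> nat, finite_valued h &
    forall chi psi, h chi = h psi -> `|g chi - g psi| <= e.
Proof.
move=> e0 g02 mg.
pose h chi := Num.truncn (g chi / e).
have ge chi : 0 <= g chi / e by have /andP[? _] := g02 chi; rewrite divr_ge0 // ltW.
have hP chi : (h chi)%:R * e <= g chi < (h chi).+1%:R * e.
  by have := truncn_itv (ge chi); rewrite ler_pdivlMr // ltr_pdivrMr.
exists h.
  split.
    apply: (@sub_finite_set _ _ `I_(Num.truncn (2 / e)).+1); last exact: finite_II.
    move=> _ [chi _ <-]; rewrite /= ltnS; apply: le_truncn.
    by have /andP[_ ?] := g02 chi; rewrite ler_pM2r ?invr_gt0.
  move=> n.
  have -> : h @^-1` [set n] = [set chi | g chi < n.+1%:R * e] `\` [set chi | g chi < n%:R * e].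
    apply/seteqP; split=> chi /=.
      by move=> <-; have /andP[? ?] := hP chi; split=> //; apply/negP; rewrite -leNgt.
    move=> [? /negP]; rewrite -leNgt => ?.
    apply/eqP; rewrite /h truncn_eq // ler_pdivlMr // ltr_pdivrMr //.
    by apply/andP.
  exact: measurableD.
move=> chi psi hE; have := hP chi; have := hP psi; rewrite hE.
move=> /andP[a1 a2] /andP[b1 b2]; rewrite mulrSr in a2 b2.
by rewrite ler_norml; apply/andP; split; nra.
Qed.

Lemma finite_partition_coord t (e : R) : 0 < e ->
  exists2 h : bdual -> nat * nat, finite_valued h &
    forall chi psi : dual, h chi = h psi -> rnorm (char_val chi t - char_val psi t : C) <= e.
Proof.
move=> e0; have e2 : 0 < e / 2 by rewrite divr_gt0.
have part (f : C -> R) : (forall z, `|f z| <= rnorm z) ->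
    (forall z w, f (z - w) = f z - f w) ->
    exists2 h : bdual -> nat, finite_valued h & forall chi psi : dual,
      h chi = h psi -> `|f (char_val chi t) - f (char_val psi t)| <= e / 2.
  move=> f_le fB.
  have [chi|r|h fh hP] := @finite_partition_real (fun chi => f (char_val chi t) + 1) _ e2.
  - by have := f_le (char_val chi t); rewrite char_val_norm ler_norml => /andP[? ?]; lra.
  - apply: open_measurable_dual; rewrite openE => chi /= chir.
    have d0 : 0 < r - (f (char_val chi t) + 1) by rewrite subr_gt0.
    have /cvg_rnormP /(_ _ d0) := @char_val_continuous t chi.
    apply: filterS => psi /(le_lt_trans (f_le _)); rewrite fB ltr_norml => /andP[? ?] /=.
    lra.
  - exists h => // chi psi /hP; congr (`|_| <= _); ring.
have [h1 fh1 h1P] := part (fun z => complex.Re z) (@Re_rnorm R)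
  ltac:(move=> [? ?] [? ?]; reflexivity).
have [h2 fh2 h2P] := part (fun z => complex.Im z) (@Im_rnorm R)
  ltac:(move=> [? ?] [? ?]; reflexivity).
exists (fun chi => (h1 chi, h2 chi)); first exact: finite_valued_pair.
move=> chi psi [/h1P H1 /h2P H2]; apply: le_trans (rnorm_ReIm _) _.
have -> : complex.Re (char_val chi t - char_val psi t : C) =
  complex.Re (char_val chi t) - complex.Re (char_val psi t).
  by case: (char_val chi t) (char_val psi t) => ? ? [? ?].
have -> : complex.Im (char_val chi t - char_val psi t : C) =
  complex.Im (char_val chi t) - complex.Im (char_val psi t).
  by case: (char_val chi t) (char_val psi t) => ? ? [? ?].
lra.
Qed.

Lemma finite_partition (Q : seq Gamma) (e : R) : 0 < e ->
  exists2 h : bdual -> seq (nat * nat), finite_valued h &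
    forall chi psi : dual, h chi = h psi -> forall t, t \in Q ->
      rnorm (char_val chi t - char_val psi t : C) <= e.
Proof.
move=> e0; elim: Q => [|t Q [h fh hP]].
  exists (fun=> [::]) => //; split.
    by apply: (@sub_finite_set _ _ [set [::]]) => // _ [_ _ <-].
  move=> i; have [<-|i0] := eqVneq [::] i.
    by rewrite (_ : _ @^-1` _ = setT) //; apply/seteqP.
  by rewrite (_ : _ @^-1` _ = set0) //; apply/seteqP; split=> // x /= /eqP; rewrite (negbTE i0).
have [k fk kP] := finite_partition_coord t e0.
exists (fun chi => k chi :: h chi).
  exact: (finite_valued_comp (fun p => p.1 :: p.2) (finite_valued_pair fk fh)).
move=> chi psi [/kP Ht /hP HQ] s; rewrite in_cons => /orP[/eqP ->//|]; exact: HQ.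
Qed.

End DualGroupMeasure.

(** * The projections onto the spectral subspaces *)

Section SpectralSubspace.
Context (R : realType) (G : topologicalType) (S : groupoid G).
Context (A : reduced_algebra R S) (Gamma : zmodType).
Context (c : G -> Gamma) (hc : cocycle S c).
Context (mu : probability (borel_dual R Gamma) R) (hmu : haar mu).
Local Notation C := (R[i]^o).
Local Notation j := (fourier_coef (A := A)).
Local Notation bdual := (borel_dual R Gamma).
Implicit Types (f g : G -> C) (a b : A) (chi psi : dual_group R Gamma).

Lemma fourier_sum (I : Type) (r : seq I) (F : I -> A) x :
  j (\sum_(i <- r) F i) x = \sum_(i <- r) (j (F i) x : C).
Proof.
elim: r => [|i r IH]; first by rewrite !big_nil fourier0.
by rewrite !big_cons fourierD IH.
Qed.

(** The integrand of Phi_t. *)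
Definition twist (t : Gamma) a (chi : bdual) : A :=
  (char_val chi t)^*%C *: dual_action c chi a.

Lemma twistB t a b chi : twist t a chi - twist t b chi = twist t (a - b) chi.
Proof.
rewrite /twist -scalerBr; congr (_ *: _).
by apply: fourier_inj => x; rewrite fourierB !(dual_actionE hc) fourierB mulrBr.
Qed.

Lemma coef_twist t a chi x : j (twist t a chi) x = char_val chi (c x - t) * j a x :> C.
Proof.
by rewrite fourierZ (dual_actionE hc) conjc_char char_valD char_valN mulrA [X in X * _]mulrC.
Qed.

Lemma twist_norm t a chi : rnorm (twist t a chi) = rnorm a.
Proof.
rewrite /twist rnormZ dual_action_norm // conjc_char -char_valN char_val_norm.
by rewrite mul1r.
Qed.

(** On the fibre of c over s, the twist by chi is multiplication by the constant
    chi(s - t). *)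
Lemma twist_incl t f (Q : seq Gamma) chi : Cc setT f -> uniq Q ->
  (forall x, f x != 0 -> c x \in Q) ->
  twist t (incl A f) chi = \sum_(s <- Q) char_val chi (s - t) *: incl A (fiber_part c s f).
Proof.
move=> cf uQ fQ; apply: fourier_inj => x; rewrite coef_twist fourier_incl // fourier_sum.
have E s : j (char_val chi (s - t) *: incl A (fiber_part c s f)) x =
    char_val chi (c x - t) * fiber_part c s f x :> C.
  rewrite fourierZ fourier_incl; last exact: Cc_setT (Cc_fiber_part hc s cf).
  by rewrite /fiber_part; case: eqP => [->//|]; rewrite !mulr0.
under eq_bigr do rewrite E.
rewrite -mulr_sumr; congr (_ * _).
by rewrite {1}(sum_fiber_part uQ fQ) fct_sumE.
Qed.

(** Approximate a by a function of compact support: that function meets finitely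
    many fibres of c, and so its twist depends continuously on finitely many
    coordinates of the character. *)
Lemma twist_modulus t a (e : R) : 0 < e -> exists (Q : seq Gamma) (d : R),
  0 < d /\ forall chi psi : bdual,
    (forall s, s \in Q -> rnorm (char_val chi s - char_val psi s : C) <= d) ->
    rnorm (twist t a chi - twist t a psi) <= e.
Proof.
move=> e0; have e4 : 0 < e / 4 by rewrite divr_gt0.
have [f cf af] := incl_approx a e4.
have [Q uQ fQ] := Cc_fibers hc cf.
pose B := \sum_(s <- Q) rnorm (incl A (fiber_part c s f)).
have B0 : 0 <= B by apply: sumr_ge0 => s _; exact: rnorm_ge0.
have B1 : 0 < (B + 1) * 2 by rewrite mulr_gt0 // ltr_wpDl.
exists [seq s - t | s <- Q], (e / ((B + 1) * 2)); split; first by rewrite divr_gt0.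
move=> chi psi close.
set d := e / _ in close.
have dB : d * (B + 1) * 2 = e by rewrite -mulrA divfK // gt_eqF.
have d0 : 0 < d by rewrite divr_gt0.
have fd : rnorm (twist t (incl A f) chi - twist t (incl A f) psi) <= d * B.
  rewrite !(twist_incl _ _ cf uQ fQ) -sumrB /B mulr_sumr big_seq [leRHS]big_seq.
  elim/big_ind2: _ => [|x1 x2 y1 y2 H1 H2|s sQ]; first by rewrite rnorm0.
    by apply: le_trans (ler_rnormD _ _) _; exact: lerD.
  rewrite -scalerBl rnormZ; apply: ler_wpM2r; first exact: rnorm_ge0.
  by apply: close; apply: map_f.
have close_f phi : rnorm (twist t a phi - twist t (incl A f) phi) < e / 4.
  by rewrite twistB twist_norm.
have := close_f chi; have := close_f psi.
have := ler_rnormB (twist t a chi) (twist t (incl A f) chi) (twist t a psi).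
have := ler_rnormB (twist t (incl A f) chi) (twist t (incl A f) psi) (twist t a psi).
rewrite (rnormBC (twist t (incl A f) psi)).
have dB' : d * B <= e / 2.
  have : d * B <= d * (B + 1) by apply: ler_wpM2l; [exact: ltW|rewrite lerDl].
  by lra.
by move: fd; clear close close_f dB; rnorm_lra.
Qed.

(** Freeze the character to one representative on each piece of a partition on
    which the relevant coordinates are almost constant. *)
Lemma twist_simple t a (n : nat) : exists s : bdual -> A,
  [/\ simple_map s, range s `<=` range (twist t a) &
     forall chi, rnorm (twist t a chi - s chi) <= inv_succ R n].
Proof.
have [Q [d [d0 Qd]]] := twist_modulus t a (inv_succ_gt0 R n).
have [h fh hP] := @finite_partition R Gamma Q d d0.
pose rep (i : seq (nat * nat)) : bdual := xget (char1 R Gamma) [set chi | h chi = i].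
have repP chi : h (rep (h chi)) = h chi.
  have : exists psi, [set psi | h psi = h chi] psi by exists chi.
  by move=> /(xgetPex (char1 R Gamma)).
exists (twist t a \o rep \o h); split.
- exact: (finite_valued_comp (twist t a \o rep) fh).
- by move=> _ [chi _ <-]; exists (rep (h chi)).
- by move=> chi; apply: Qd => s sQ; apply: hP => //; rewrite repP.
Qed.

Lemma Phi_limit t a : exists s : nat -> bdual -> A,
  [/\ forall n, simple_map (s n), forall n, range (s n) `<=` range (twist t a),
    simple_integral mu (s n) @[n --> \oo] --> Phi c mu t a &
    is_bochner_integral mu (twist t a) (Phi c mu t a)].
Proof.
have [s [x [ss sF sx Fx]]] := @bochner_exists _ _ _ mu A (twist t a) (twist_simple t a).
by exists s; have -> : Phi c mu t a = x := bochner_integralE Fx.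
Qed.

(** The approximating simple maps take their values in M, and so do their integrals
    and the limit of these. *)
Lemma Phi_invariant (M : set A) t a : closed M -> M 0 ->
  (forall k a b, M a -> M b -> M (k *: a + b)) -> dual_invariant c M ->
  M a -> M (Phi c mu t a).
Proof.
move=> cM M0 Mlin Minv Ma.
have [s [ss sF sx _]] := Phi_limit t a.
apply: (@closed_cvg _ _ _ _ _ M cM _ _ sx); apply: nearW => n.
have sM v : range (s n) v -> M v.
  move=> /sF [chi _ <-]; rewrite /twist -[_ *: _]addr0; apply: Mlin => //.
  by apply: (Minv chi); exists a.
rewrite /simple_integral fsbig_finite; last by case: (ss n).
rewrite /= big_seq; elim/big_rec: _ => // v b vs Mb; apply: Mlin => //.
by apply: sM; move: vs; rewrite in_fset_set ?inE //; case: (ss n).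
Qed.

(** Where c x = t, all values of the integrand have the x-coefficient of a, and the
    total mass is 1. *)
Lemma coef_Phi_eq t a x : c x = t -> j (Phi c mu t a) x = j a x.
Proof.
move=> cx; have [s [ss sF sx _]] := Phi_limit t a.
have sj n v : range (s n) v -> j v x = j a x.
  by move=> /sF [chi _ <-]; rewrite coef_twist cx subrr char_val0 mul1r.
have jint n : j (simple_integral mu (s n)) x = j a x.
  have [fs ms] := ss n.
  rewrite /simple_integral fsbig_finite //= fourier_sum.
  transitivity (\sum_(v <- fset_set (range (s n)))
      ((fine (mu (s n @^-1` [set v])))%:C%C * j a x : C)).
    rewrite big_seq [RHS]big_seq; apply: eq_bigr => v vs.
    rewrite fourierZ (sj n) //.
    by move: vs; rewrite in_fset_set ?inE.
  rewrite -mulr_suml -rmorph_sum /= -fsbig_finite //.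
  rewrite (_ : \sum_(v \in _) _ = 1 :> R) ?mul1r //.
  apply: EFin_inj; rewrite -(integral_cstP mu 1).
  rewrite (integral_finite_valued mu (g := fun=> 1) (ss n) fs (@subset_refl _ _)) //.
  by congr (_%:E); apply: eq_fsbigr => v _; rewrite mul1r.
apply/eqP; rewrite -subr_eq0; apply/eqP; apply: (@rnorm_le0 R C) => e e0.
move/cvg_rnormP: sx => /(_ _ e0) => /filter_ex[n /ltW].
by have := fourier_norm (Phi c mu t a - simple_integral mu (s n)) x;
  rewrite fourierB jint; exact: le_trans.
Qed.

(** Invariance of Haar measure under a character psi shows that psi(c x - t)
    fixes the x-coefficient of the integral; pick psi nontrivial at c x - t. *)
Lemma coef_Phi_neq t a x : c x <> t -> j (Phi c mu t a) x = 0.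
Proof.
move=> cx; have [_ [_ _ _ Fx]] := Phi_limit t a.
have ct : c x - t != 0 by rewrite subr_eq0; apply/eqP.
have [psi psi1] := char_separates R ct.
pose U b := twist t b psi.
have Ulin k b1 b2 : U (k *: b1 + b2) = k *: U b1 + U b2.
  by apply: fourier_inj => y; rewrite fourier_lin !coef_twist fourier_lin mulrDr mulrCA.
have UF : U \o twist t a = twist t a \o (charM psi : bdual -> bdual).
  apply/funext => chi; apply: fourier_inj => y.
  by rewrite /= !coef_twist char_valM mulrA.
have E1 := bochner_isometry Ulin (fun b => twist_norm t b psi) Fx.
have E2 : is_bochner_integral mu (twist t a \o (charM psi : bdual -> bdual)) (Phi c mu t a).
  apply: bochner_translate Fx.
  - exact: charM_measurable.
  - move=> chi _; exists (charM (charV psi) chi) => //=.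
    apply: char_ext => s; rewrite !char_valM char_valV mulrA mulfV ?mul1r //.
    exact: char_val_neq0.
  - by move=> E mE; exact: haar_translate.
rewrite UF in E1; have UP := bochner_unique E1 E2.
have : j (U (Phi c mu t a)) x = j (Phi c mu t a) x by rewrite UP.
rewrite coef_twist => /eqP; rewrite -subr_eq0 -{2}[j _ x]mul1r -mulrBl mulf_eq0.
by rewrite subr_eq0 (negbTE psi1) => /eqP.
Qed.

Lemma spectral_subspaceE t :
  spectral_subspace c mu t = supported_in [set x | c x = t] :> set A.
Proof.
apply/seteqP; split=> [_ [a _ <-] x|a aP]; first exact: coef_Phi_neq.
exists a => //; apply: fourier_inj => x.
have [/eqP cx|/eqP cx] := boolP (c x == t); first exact: coef_Phi_eq.
by rewrite coef_Phi_neq // aP.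
Qed.

End SpectralSubspace.

(** * Functions on open bisections *)

Section Bisection.
Context (R : realType) (G : topologicalType) (S : groupoid G) (hS : etale S).
Context (Gamma : zmodType) (c : G -> Gamma) (hc : cocycle S c).
Local Notation C := (R[i]^o).
Implicit Types (e f : G -> C) (t : Gamma).

Lemma src_continuous : continuous (src S).
Proof.
move=> x; have [_ /(_ x) [U [oU Ux _ [g [cU _ _]]]]] := etale_src hS.
by move: cU; rewrite continuous_open_subspace // => /(_ x (mem_set Ux)).
Qed.

Context (c0 : c @^-1` [set 0] = unit_space S).

(** If c x = c y and x, y have the same source, then x y^-1 is a unit. *)
Lemma src_inj_fiber x y : c x = c y -> src S x = src S y -> x = y.
Proof.
have [_ cM] := hc => cxy sxy.
have : unit_space S (gmul S x (ginv S y)).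
  by rewrite -c0 /= (cocycle_div cM) // cxy subrr.
move=> uU; have uE := unit_src uU.
rewrite src_mul ?rng_inv // src_inv in uE.
have := mul_assoc (g := S) (x := x) (y := ginv S y) (z := y).
rewrite rng_inv src_inv => /(_ sxy erefl).
by rewrite mul_inv_l -sxy mul_src -uE mul_rng.
Qed.

(** The fibre over t is an open bisection, and so the source map carries
    functions on it to functions on the unit space. *)
Lemma transfer_to_units t e : Cc [set x | c x = t] e ->
  exists2 d, Cc (unit_space S) d & forall x, c x = t -> d (src S x) = e x.
Proof.
move=> ce; have [cte ke se] := ce.
(* The default value 0 is taken off the source image of the fibre. *)
pose d u : C := xget 0 [set z : C | exists x, [/\ c x = t, src S x = u & z = e x]].
have dE x : c x = t -> d (src S x) = e x.
  move=> cx.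
  have : exists z, [set z : C | exists y, [/\ c y = t, src S y = src S x & z = e y]] z.
    by exists (e x), x.
  by move=> /(xgetPex 0) [y [cy yx] dy]; rewrite /d dy (@src_inj_fiber y x) // cx.
exists d => //.
set K := closure _ in ke se; pose sK := src S @` K.
have csK : compact sK.
  by apply: continuous_compact => //; apply: continuous_subspaceT; exact: src_continuous.
have clK : closed sK by apply: compact_closed csK; exact: etale_hausdorff hS.
have dK u : ~ sK u -> d u = 0.
  move=> uK; rewrite /d; case: xgetP => // z -> [x [cx xu ->]].
  apply/eqP; apply: contra_notT uK => ex; exists x => //.
  exact: subset_closure.
apply: (Cc_compact (etale_hausdorff hS) _ csK) => //; last first.
  by move=> _ [x _ <-]; exists x.
move=> u; rewrite /continuous_at; have [[x Kx xu]|uK] := pselect (sK u); last first.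
  have -> : d u = 0 by exact: dK.
  apply: (@cvg_trans _ ((fun=> 0 : C) @ u)); last exact: cvg_cst.
  apply: near_eq_cvg.
  have : nbhs u (~` sK) by apply: open_nbhs_nbhs; split => //; exact: closed_openC.
  by apply: filterS => v /dK ->.
have [_ /(_ x) [U [oU Ux [V oV UV] [g [_ cg gK]]]]] := etale_src hS.
have oW : open (src S @` U).
  by rewrite UV -c0; apply: openI => //; exact: (cocycle_fiber_open hc 0).
have Wu : (src S @` U) u by exists x.
have gu : g u = x by rewrite -xu gK.
have cgu : g @ u --> g u.
  by move: cg; rewrite continuous_open_subspace // => /(_ u (mem_set Wu)).
have -> : d u = e (g u) by rewrite gu -xu dE //; exact: se.
apply: (@cvg_trans _ ((e \o g) @ u)); last first.
  by apply: (cvg_comp _ _ cgu); exact: cte.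
apply: near_eq_cvg; near=> v.
have [y Uy yv] : (src S @` U) v by near: v; apply: open_nbhs_nbhs; split.
have cgv : c (g v) = c (g u).
  by near: v; exact: (cgu (fun w => c w = c (g u)) (cocycle_near hc (g u))).
have gv : g v = y by rewrite -yv gK.
rewrite /= -{2}yv gv dE // -gv cgv gu.
exact: se.
Unshelve. all: by end_near. Qed.

(** The quotient vanishes on the complement of the closed support of f, which is
    open and contains all zeros of h. *)
Lemma continuous_quotient f (h : G -> C) : continuous f -> continuous h ->
  (forall x, closure [set x | f x != 0] x -> h x != 0) ->
  continuous (fun x => f x / h x : C).
Proof.
move=> cf ch fh x; set K := closure _ in fh.
have [Kx|Kx] := pselect (K x).
  by apply: cvgM; [exact: cf|apply: cvgV; [exact: fh|exact: ch]].
have f0 y : ~ K y -> f y = 0 by exact: eq0_off_support.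
rewrite /continuous_at (f0 x Kx) mul0r.
apply: (@cvg_trans _ ((fun=> 0 : C) @ x)); last exact: cvg_cst.
apply: near_eq_cvg.
have : nbhs x (~` K).
  by apply: open_nbhs_nbhs; split => //; apply: closed_openC; exact: closed_closure.
by apply: filterS => y /f0 ->; rewrite mul0r.
Qed.

Lemma conjc_continuous : continuous (fun z : C => z^*%C : C).
Proof.
move=> z; apply: (@cvg_rnormP R C C _ (nbhs_filter (z : C)) _ _).2 => e e0.
have : \forall w \near z, rnorm (z - w) < e.
  by apply/nbhs_rnormP; exists e.
apply: filterS => w; suff -> : rnorm (z^*%C - w^*%C : C) = rnorm (z - w) by [].
rewrite -rmorphB /rnorm !normc_def; case: (z - w) => a b /=.
by rewrite sqrrN.
Qed.

Lemma mul_conjc_rnorm (z : C) : z * z^*%C = (rnorm z ^+ 2)%:C%C.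
Proof. by rewrite rmorphXn /= -rnormE sqr_normc. Qed.

Context (A : reduced_algebra R S).
Local Notation j := (fourier_coef (A := A)).

(** In the convolution with a function supported on units only the term at the
    source of x survives; continuity of the product extends this from C_c to the
    whole algebra. *)
Lemma coef_mul_diag (a : A) d x : Cc (unit_space S) d ->
  j (amul a (incl A d)) x = j a x * d (src S x) :> C.
Proof.
move=> cd; have [ctd _ _] := cd.
have d0 y : ~ unit_space S y -> d y = 0 by exact: Cc_eq0 cd.
pose f n := approx_seq a n.
have fP n : Cc setT (f n) := (approx_seqP a n).1.
pose m n y : C := f n y * d (src S y).
have mP n : Cc setT (m n).
  apply: (Cc_supp (fP n)); last by move=> y fy; rewrite /m fy mul0r.
  have [cf _ _] := fP n.
  move=> y; apply: cvgM; first exact: cf.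
  exact: (continuous_comp (@src_continuous y) (ctd _)).
have convE n : convolution S (f n) d = m n.
  apply/funext => y; rewrite /convolution -(@fsbig_widen _ _ _ _ [set src S y]) ?fsbig_set1.
  - by rewrite mul_inv_src.
  - by move=> _ ->; rewrite /src_fiber /= src_src.
  - move=> z [zy /= zsy]; have [zU|zU] := pselect (unit_space S z).
      by exfalso; apply: zsy; rewrite -(unit_src zU) zy.
    by rewrite d0 ?mulr0.
have fa : incl A (f n) @[n --> \oo] --> a.
  apply/cvg_rnormP => e e0.
  have := near_inv_nat e0; apply: filterS => n; apply: lt_trans.
  exact: (approx_seqP a n).2.
have ma : incl A (m n) @[n --> \oo] --> amul a (incl A d).
  have -> : (fun n => incl A (m n)) =
      (fun p : A * A => amul p.1 p.2) \o (fun n => (incl A (f n), incl A d)).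
    by apply/funext => n /=; rewrite amul_incl ?convE //; exact: Cc_setT cd.
  apply: cvg_comp; last exact: (@amul_continuous _ _ _ A (a, incl A d)).
  by apply: cvg_pair => //; exact: cvg_cst.
have mx := incl_cvg_coef (x := x) mP ma.
have fx := incl_cvg_coef (x := x) fP fa.
have fdx : m n x @[n --> \oo] --> (j a x * d (src S x) : C) by exact: cvgMr_tmp.
by apply: (cvg_unique _ mx fdx); exact: norm_hausdorff.
Qed.

Lemma incl_diagonal d : Cc (unit_space S) d -> diagonal_subalgebra (incl A d).
Proof.
move=> cd; rewrite /diagonal_subalgebra /= fourier_incl; last exact: Cc_setT cd.
have [ctd kd sd] := cd.
split.
- exact: continuous_subspaceT.
- by move=> x; exact: Cc_eq0 cd.
- move=> e e0; exists (closure [set x | d x != 0]) => // x _ /eq0_off_support ->.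
  by rewrite rnorm0.
Qed.

End Bisection.

(** * Spectral bimodules *)

Section Spectral.
Context (R : realType) (G : topologicalType) (S : groupoid G).
Context (A : reduced_algebra R S) (Gamma : zmodType).
Context (c : G -> Gamma) (hc : cocycle S c).
Context (mu : probability (borel_dual R Gamma) R) (hmu : haar mu).
Local Notation C := (R[i]^o).
Local Notation j := (fourier_coef (A := A)).
Local Notation "M '_[' t ]" := (M `&` spectral_subspace c mu t)
  (at level 30, format "M '_[' t ]").
Implicit Types (f : G -> C) (a b : A) (M : set A).

Lemma sub_supported_in M : M `<=` supported_in (spectrum M).
Proof.
move=> a Ma x xM; apply/eqP; apply: contra_notT xM => ax.
by exists a.
Qed.

Lemma spectral_dual_invariant M : spectral M -> dual_invariant c M.
Proof.
move=> Msp chi _ [a Ma <-]; rewrite Msp => x xM.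
by rewrite (dual_actionE hc) (sub_supported_in Ma) // mulr0.
Qed.

Lemma spectrum_part_sub M t : spectrum (M _[t]) `<=` [set x | c x = t].
Proof.
move=> x [a [_]]; rewrite (spectral_subspaceE A hc hmu) => at_ ax.
by apply: contrapT => cx; move: ax; rewrite at_ ?eqxx.
Qed.

(** An element of M with a nonzero coefficient over t is mapped by Phi_t to an element
    of M_t with the same coefficient. *)
Lemma spectrum_part M t : (forall a, M a -> M (Phi c mu t a)) ->
  spectrum (M _[t]) = spectrum M `&` [set x | c x = t].
Proof.
move=> MPhi; apply/seteqP; split=> x.
  by move=> xM; split; [case: xM => a [Ma _] ax; exists a|exact: spectrum_part_sub xM].
move=> [[a Ma ax] cx]; exists (Phi c mu t a); last by rewrite (coef_Phi_eq hc mu).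
by split; [exact: MPhi|exists a].
Qed.

Lemma spectral_part M t : spectral M -> spectral (M _[t]).
Proof.
move=> Msp; have MPhi a : M a -> M (Phi c mu t a).
  move=> Ma; rewrite Msp => x xM.
  have [cx|cx] := pselect (c x = t).
    by rewrite (coef_Phi_eq hc mu) // (sub_supported_in Ma).
  by rewrite (coef_Phi_neq hc hmu).
apply/seteqP; split; first exact: sub_supported_in.
rewrite (spectrum_part MPhi) (spectral_subspaceE A hc hmu) => a aP.
split; last by move=> x cx; apply: aP => -[].
by rewrite Msp => x xM; apply: aP => -[].
Qed.

(** Under the approximation property, membership of an invariant M is decided by
    compactly supported functions, one fibre of the cocycle at a time. *)
Lemma spectral_criterion M : fourier_approximation A -> closed M -> M 0 ->
  (forall k a b, M a -> M b -> M (k *: a + b)) -> dual_invariant c M ->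
  (forall t f, Cc (spectrum (M _[t])) f -> M (incl A f)) -> spectral M.
Proof.
move=> hA cM M0 Mlin Minv Mf.
apply/seteqP; split; first exact: sub_supported_in.
move=> b bM.
have supp_b : supp' b `<=` spectrum M.
  by move=> x; apply: contraNP => /bM ->.
rewrite (closure_id M).1 //.
have sub : incl A @` Cc (supp' b) `<=` M; last exact: (closureS sub (hA b)).
move=> _ [f cf <-]; have {}cf := Cc_sub supp_b cf.
have [Q uQ fQ] := Cc_fibers hc cf.
have partM t : M (incl A (fiber_part c t f)).
  apply: (Mf t); rewrite spectrum_part; first exact: (Cc_fiber_part hc t cf).
  by move=> a; exact: Phi_invariant.
have -> : incl A f = \sum_(t <- Q) incl A (fiber_part c t f).
  apply: fourier_inj => x; rewrite fourier_incl; last exact: Cc_setT cf.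
  rewrite fourier_sum {1}(sum_fiber_part uQ fQ) fct_sumE; apply: eq_bigr => t _.
  by rewrite fourier_incl //; exact: Cc_setT (Cc_fiber_part hc t cf).
elim/big_rec: _ => // t b' _ Mb'.
by rewrite -[incl A _]scale1r; exact: Mlin.
Qed.

(** Compactness yields finitely many a in M_t without common zero on the
    support of f, and then f is the sum of the a * d_a, where d_a is the
    function on the unit space that corresponds to a^* f / sum |a|^2. *)
Lemma bisection_part M t f : etale S -> diagonal_bimodule M ->
  c @^-1` [set 0] = unit_space S -> Cc (spectrum (M _[t])) f -> M (incl A f).
Proof.
move=> hS [_ M0 Mlin Mbi] c0 cf; have [ctf kf sf] := cf.
have at0 a x : (M _[t]) a -> c x <> t -> j a x = 0.
  by move=> [_]; rewrite (spectral_subspaceE A hc hmu) => + cx; apply.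
have [|Q fQ] := compact_finite_cover
    (U := fun a => [set x | (M _[t]) a /\ j a x != 0]) kf.
  move=> x /sf [a Ma ax]; exists a.
  have ax0 : 0 < rnorm (j a x : C).
    rewrite lt_neqAle rnorm_ge0 andbT eq_sym; apply: contra_neq ax.
    exact: rnorm_eq0.
  have /cvg_rnormP /(_ _ ax0) := @fourier_continuous _ _ _ A a x.
  apply: filterS => y xy; split=> //; apply: contraTneq xy => ->.
  by rewrite subr0 ltxx.
pose Q' := [seq a <- Q | `[< (M _[t]) a >]].
have Q'P a : a \in Q' -> (M _[t]) a by rewrite mem_filter => /andP[/asboolP].
pose h x : C := \sum_(a <- Q') j a x * (j a x)^*%C.
have hE x : h x = (\sum_(a <- Q') rnorm (j a x : C) ^+ 2)%:C%C.
  by rewrite rmorph_sum; apply: eq_bigr => a _; exact: mul_conjc_rnorm.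
have h0 x : closure [set x | f x != 0] x -> h x != 0.
  move=> /fQ [a aQ [Ma ax]].
  have aQ' : a \in Q' by rewrite mem_filter aQ andbT; apply/asboolP.
  have ax0 : 0 < rnorm (j a x : C).
    rewrite lt_neqAle rnorm_ge0 andbT eq_sym; apply: contra_neq ax.
    exact: rnorm_eq0.
  have hx0 : 0 < \sum_(a <- Q') rnorm (j a x : C) ^+ 2.
    rewrite (big_rem a) //= ltr_pwDl ?exprn_gt0 // sumr_ge0 // => b _.
    by rewrite sqr_ge0.
  by rewrite hE gt_eqF // ltcR.
have cj a : continuous (fun x => (j a x)^*%C : C).
  move=> x; apply: (continuous_comp (f := j a) (g := fun z : C => z^*%C : C)).
    exact: fourier_continuous.
  exact: conjc_continuous.
have ch : continuous h.
  apply: continuous_big => [|a _]; first exact: add_continuous.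
  by move=> x; apply: cvgM; [exact: fourier_continuous|exact: cj].
pose e a x : C := (j a x)^*%C * (f x / h x).
have ce a : Cc [set x | c x = t] (e a).
  apply: (Cc_supp (Cc_sub (@spectrum_part_sub M t) cf)).
    by move=> x; apply: cvgM; [exact: cj|exact: (continuous_quotient ctf ch h0)].
  by move=> x fx; rewrite /e fx mul0r mulr0.
have /choice[d dP] a : exists d, Cc (unit_space S) d /\
    forall x, c x = t -> d (src S x) = e a x.
  by have [d d1 d2] := transfer_to_units hS hc c0 (ce a); exists d.
have -> : incl A f = \sum_(a <- Q') amul a (incl A (d a)).
  apply: fourier_inj => x; rewrite fourier_incl; last exact: Cc_setT cf.
  rewrite fourier_sum.
  have [cx|cx] := pselect (c x = t); last first.
    rewrite big_seq big1 => [|a aQ']; last first.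
      rewrite (coef_mul_diag hS); last by case: (dP a).
      by rewrite at0 ?mul0r //; exact: Q'P.
    by apply: (Cc_eq0 cf) => /spectrum_part_sub.
  transitivity (h x * (f x / h x)).
    have [Kx|/eq0_off_support ->] := pselect (closure [set x | f x != 0] x).
      by rewrite mulrC divfK // h0.
    by rewrite mul0r mulr0.
  rewrite mulr_suml; apply: eq_bigr => a _.
  rewrite (coef_mul_diag hS); last by case: (dP a).
  by have [_ dE] := dP a; rewrite dE // /e -mulrA.
rewrite big_seq; elim/big_rec: _ => // a b aQ' Mb.
rewrite -[amul _ _]scale1r; apply: Mlin => //.
have [Ma _] := Q'P a aQ'.
by apply: (Mbi _ _ Ma _).1; apply: incl_diagonal; case: (dP a).
Qed.

End Spectral.

Unset Implicit Arguments.

Theorem proposition4p3 (R : realType) (G : topologicalType) (S : groupoid G)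
    (hS : etale S) (A : reduced_algebra R S) (hA : fourier_approximation A)
    (Gamma : zmodType) (hcount : countable [set: Gamma])
    (hinf : infinite_set [set: Gamma])
    (mu : probability (borel_dual R Gamma) R) (hmu : haar mu)
    (c : G -> Gamma) (hc : cocycle S c)
    (M : set A) (hM : diagonal_bimodule M) :
  (dual_invariant c M ->
     (spectral M <->
      forall t : Gamma, spectral (M `&` spectral_subspace c mu t))) /\
  ((spectral M -> dual_invariant c M) /\
   (c @^-1` [set 0] = unit_space S -> (spectral M <-> dual_invariant c M))).
Proof.
have [cM M0 Mlin _] := hM.
split; [|split].
- move=> Minv; split=> [Msp t|Msp]; first exact: spectral_part.
  apply: (spectral_criterion hc hmu hA cM M0 Mlin Minv) => t f cf.
  suff [] : (M `&` spectral_subspace c mu t) (incl A f) by [].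
  rewrite (Msp t) => x xP; rewrite fourier_incl; last exact: Cc_setT cf.
  exact: Cc_eq0 cf xP.
- exact: spectral_dual_invariant.
- move=> c0; split=> [|Minv]; first exact: spectral_dual_invariant.
  apply: (spectral_criterion hc hmu hA cM M0 Mlin Minv) => t f cf.
  exact: (bisection_part hc hmu hS hM c0 cf).
Qed.
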